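(* Let $y$ be the exact solution on $I=[0,1]$ of the Fredholm fractional integro-differential initial value problem $$\sum_{i=0}^{n} a_i\, y^{(i)}(t) = f(t) + \int_0^1 k(t,s)\, D^\alpha y(s)\, ds,\quad t\in[0,1],\qquad y^{(i)}(0)=d_i,\quad i=0,1,\ldots,n-1,$$ where $m-1<\alpha\le m$, $m\in\mathbb{N}$, $D^\alpha$ is the Caputo derivative, $a_i$ and $d_i$ are constants, and $f$ and $k$ are given sufficiently smooth functions; the problem is assumed to have a unique solution. For sufficiently large $N$, let $y_N$ be the Chebyshev-Legendre spectral approximation of degree at most $N$ to $y$, i.e. the polynomial $y_N=\sum_{j=0}^N c_j L_{1,j}$ determined by $$\sum_{i=0}^{n} a_i\,\bigl(y_N^{(i)}, L_{1,r}\bigr) = \bigl(I_N^c f, L_{1,r}\bigr) + \Bigl(\int_0^1 I_N^c k(\cdot,s)\, D^\alpha y_N(s)\, ds,\; L_{1,r}\Bigr),\qquad r=0,1,\ldots,N-n,$$ $$y_N^{(i)}(0)=d_i,\qquad i=0,1,\ldots,n-1.$$ Then the approximations $y_N$ converge to the exact solution in the $L^2$-norm, i.e. $$\|y-y_N\|_{L^2(I)}\to 0\quad\text{as } N\to\infty.$$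
   Context: Notation. $I=[0,1]$; $(u,v)=\int_0^1 u(x)v(x)\,dx$ and $\|u\|_{L^2(I)}=(u,u)^{1/2}$. Caputo derivative: for $\alpha>0$ and $m=\lceil\alpha\rceil$, $$D^\alpha y(x)=\frac{1}{\Gamma(m-\alpha)}\int_0^x (x-t)^{m-\alpha-1} y^{(m)}(t)\,dt\quad\text{if } m-1<\alpha<m,\qquad D^\alpha y=y^{(m)}\quad\text{if }\alpha=m.$$ Shifted Legendre polynomials: $L_{1,i}(x)=L_i(2x-1)$ for $x\in[0,1]$, where $L_i$ is the standard Legendre polynomial of degree $i$ on $[-1,1]$ (so $L_0=1$, $L_1(t)=t$, $(i+1)L_{i+1}(t)=(2i+1)tL_i(t)-iL_{i-1}(t)$). They satisfy $\int_0^1 L_{1,j}L_{1,k}\,dx=\delta_{jk}/(2j+1)$. The approximation $y_N$ lies in $\mathrm{span}\{L_{1,0},\ldots,L_{1,N}\}$, the polynomials of degree at most $N$. Chebyshev interpolation: $I_N^c u$ is the polynomial of degree at most $N$ that interpolates $u$ at the $N+1$ Chebyshev-Gauss nodes transported to $[0,1]$, $x_j=\frac12\bigl(1-\cos\frac{(2j+1)\pi}{2N+2}\bigr)$, $j=0,\ldots,N$. In $I_N^c k(\cdot,s)$ the interpolation acts on the first variable of $k$, for each fixed $s$.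
   Formalization: The leading coefficient a_n is assumed nonzero, so that the equation really has order n; if all a_i vanish the problem is a first-kind Fredholm equation and the approximations can diverge. *)

(* Defs.v *)
From HB Require Import structures.
From mathcomp Require Import all_boot all_order all_algebra.
From mathcomp Require Import all_classical all_reals all_analysis.

Set Implicit Arguments.
Unset Strict Implicit.
Unset Printing Implicit Defensive.

Import Order.TTheory GRing.Theory Num.Theory.
Import numFieldNormedType.Exports.

Local Open Scope classical_set_scope.
Local Open Scope ring_scope.

(* Functions on [0,1] are total functions R -> R of which only the values on
   [0,1] are used; in particular derivatives are one-sided at 0 and 1, which
   is why the library's two-sided derive1 is not used. *)
Section calculus_on_01.
Context {R : realType}.
Implicit Types (g u v : R -> R) (k : R -> R -> R) (x t s : R).

Definition diffquot01 g x : set_system R :=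
  (fun t => (g t - g x) / (t - x)) @ within `[0, 1] x^'.

Definition derivable01 g x : Prop := cvg (diffquot01 g x).

Definition derive01 g x : R := lim (diffquot01 g x).

Definition derive01n (i : nat) g : R -> R := iter i derive01 g.

(* C^r([0,1]); continuity of the lower derivatives follows from their
   derivability. *)
Definition Cn01 (r : nat) g : Prop :=
  (forall i x, (i < r)%N -> 0 <= x <= 1 -> derivable01 (derive01n i g) x) /\
  {within `[0, 1], continuous (derive01n r g)}.

(* d^i/dt^i d^j/ds^j k *)
Definition partial01 (i j : nat) k t s : R :=
  derive01n i (fun t' => derive01n j (k t') s) t.

(* C^r([0,1] x [0,1]).  Only partial derivatives taken in the order
   "s first, then t" are listed: when they are jointly continuous, those in
   the other orders exist and agree with them (Schwarz). *)
Definition Cn01sq (r : nat) k : Prop :=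
  [/\ forall j t s, (j < r)%N -> 0 <= t <= 1 -> 0 <= s <= 1 ->
        derivable01 (derive01n j (k t)) s,
      forall i j t s, (i + j < r)%N -> 0 <= t <= 1 -> 0 <= s <= 1 ->
        derivable01 (fun t' => partial01 i j k t' s) t &
      forall i j, (i + j <= r)%N ->
        {within `[0, 1] `*` `[0, 1],
          continuous (fun p : R * R => partial01 i j k p.1 p.2)}].

Definition inner01 u v : R :=
  \int[@lebesgue_measure R]_(x in `[0, 1]) (u x * v x).

Definition L2norm01 u : R := Num.sqrt (inner01 u u).

Definition Gamma (z : R) : R :=
  \int[@lebesgue_measure R]_(t in `]0, +oo[) (t `^ (z - 1) * expR (- t)).

(* The order of differentiation is ceil(alpha), a natural number since alpha
   is positive wherever this is used. *)
Definition caputo (alpha : R) (y : R -> R) (x : R) : R :=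
  let m := `|Num.ceil alpha|%N in
  if alpha == m%:R then derive01n m y x
  else (Gamma (m%:R - alpha))^-1 *
       \int[@lebesgue_measure R]_(t in `[0, x])
          ((x - t) `^ (m%:R - alpha - 1) * derive01n m y t).

End calculus_on_01.

Section polynomials.
Context {R : realType}.

Fixpoint legendre (i : nat) : {poly R} :=
  match i with
  | 0 => 1
  | 1 => 'X
  | (j.+1 as l).+1 =>
      l.+1%:R^-1 *: ((2 * l + 1)%:R *: ('X * legendre l) - l%:R *: legendre j)
  end.

Definition slegendre (i : nat) : {poly R} := legendre i \Po (2%:P * 'X - 1).

Definition cheb_node (N j : nat) : R :=
  2^-1 * (1 - cos ((2 * j + 1)%:R * pi / (2 * N + 2)%:R)).

(* Interpolation at the nodes, in Lagrange form; the lemmas below show that it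
   is the polynomial of degree at most N that agrees with u at the nodes. *)
Definition cheb_interp (N : nat) (u : R -> R) : {poly R} :=
  \sum_(j < N.+1) u (cheb_node N j) *:
    \prod_(i < N.+1 | i != j)
      ((cheb_node N j - cheb_node N i)^-1 *: ('X - (cheb_node N i)%:P)).

Lemma cheb_node_inj (N : nat) :
  {in [pred j | (j <= N)%N] &, injective (cheb_node N)}.
Proof.
have N0 : (0 : R) < (2 * N + 2)%:R by rewrite ltr0n addn2.
have nodeP (j : nat) : (j <= N)%N ->
    (2 * j + 1)%:R * pi / (2 * N + 2)%:R \in `[0, (pi : R)].
  move=> jN; rewrite in_itv/=; apply/andP; split.
    by rewrite divr_ge0// mulr_ge0// pi_ge0.
  rewrite ler_pdivrMr// mulrC ler_wpM2l ?pi_ge0// ler_nat.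
  by rewrite leq_add// leq_mul2l jN orbT.
move=> i j; rewrite !inE => iN jN /mulfI.
have h2 : (2 : R)^-1 != 0 by rewrite invr_eq0 pnatr_eq0.
move=> /(_ h2) /addrI /oppr_inj /cos_inj.
move=> /(_ (nodeP _ iN) (nodeP _ jN)).
have iN0 : ((2 * N + 2)%:R : R)^-1 != 0 by rewrite invr_eq0 gt_eqF.
have pi0 : (pi : R) != 0 by rewrite gt_eqF// pi_gt0.
move=> /(mulIf iN0) /(mulIf pi0) /eqP.
by rewrite eqr_nat eqn_add2r eqn_mul2l/= => /eqP.
Qed.

Lemma size_cheb_interp (N : nat) (u : R -> R) :
  (size (cheb_interp N u) <= N.+1)%N.
Proof.
apply: (leq_trans (size_sum _ _ _)); apply/bigmax_leqP => j _.
apply: (leq_trans (size_scale_leq _ _)).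
rewrite scaler_prod; apply: (leq_trans (size_scale_leq _ _)).
apply: (leq_trans (size_poly_prod_leq _ _)); rewrite leq_subLR.
under eq_bigr do rewrite size_XsubC.
rewrite sum_nat_const muln2 -addnn addnC -addSn leq_add2r.
by rewrite (eq_card (B := predC1 j))// cardC1 card_ord.
Qed.

Lemma cheb_interpE (N : nat) (u : R -> R) (j : nat) : (j <= N)%N ->
  (cheb_interp N u).[cheb_node N j] = u (cheb_node N j).
Proof.
move=> jN; have jN1 : (j < N.+1)%N by [].
pose J := Ordinal jN1; rewrite horner_sum (bigD1 J)//= hornerZ horner_prod.
rewrite [X in _ * X + _]big1 => [|i iJ]; last first.
  rewrite !hornerE mulVf// subr_eq0; apply/eqP.
  move/(cheb_node_inj _ _) => /(_ jN (ltn_ord i)) E.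
  by case/eqP: iJ; apply: val_inj.
rewrite mulr1 big1 ?addr0// => i iJ.
rewrite hornerZ horner_prod (bigD1 J)/= 1?eq_sym//.
by rewrite !hornerE subrr /= mulr0 mul0r.
Qed.

Lemma cheb_interp_uniq (N : nat) (u : R -> R) (p : {poly R}) :
  (size p <= N.+1)%N ->
  (forall j, (j <= N)%N -> p.[cheb_node N j] = u (cheb_node N j)) ->
  p = cheb_interp N u.
Proof.
move=> sp pE; apply/eqP; rewrite -subr_eq0; apply/negPn/negP => q0.
have := @max_poly_roots _ _ [seq cheb_node N j | j <- iota 0 N.+1] q0.
rewrite size_map size_iota => /(_ _ _)/wrap[||].
- apply/allP => x /mapP[j]; rewrite mem_iota add0n ltnS/= => jN ->.
  by rewrite /root hornerD hornerN cheb_interpE// pE// subrr.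
- rewrite map_inj_in_uniq ?iota_uniq// => i j.
  by rewrite !mem_iota !add0n !ltnS/= => iN jN; exact: cheb_node_inj.
rewrite ltnNge (leq_trans (size_polyD _ _))//.
by rewrite geq_max sp size_polyN size_cheb_interp.
Qed.

End polynomials.

Section problem.
Context {R : realType}.
Variables (n : nat) (a d : nat -> R) (alpha : R).
Variables (f : R -> R) (k : R -> R -> R).

(* Classical solutions: y is C^n, as the equation requires, and
   C^(ceil alpha), as the Caputo derivative requires. *)
Definition fide_solution (y : R -> R) : Prop :=
  [/\ Cn01 (maxn n `|Num.ceil alpha|%N) y,
      forall t, 0 <= t <= 1 ->
        \sum_(i < n.+1) a i * derive01n i y t =
        f t + \int[@lebesgue_measure R]_(s in `[0, 1])
                (k t s * caputo alpha y s) &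
      forall i, (i < n)%N -> derive01n i y 0 = d i].

Definition cheb_legendre_approx (N : nat) (p : {poly R}) : Prop :=
  [/\ exists c : 'I_N.+1 -> R, p = \sum_(j < N.+1) c j *: slegendre j,
      forall r, (r + n <= N)%N ->
        \sum_(i < n.+1) a i * inner01 (horner p^`(i)) (horner (slegendre r)) =
        inner01 (horner (cheb_interp N f)) (horner (slegendre r)) +
        inner01 (fun t => \int[@lebesgue_measure R]_(s in `[0, 1])
                   ((cheb_interp N (k^~ s)).[t] * caputo alpha (horner p) s))
          (horner (slegendre r)) &
      forall i, (i < n)%N -> p^`(i).[0] = d i].

End problem.

(* Main.v *)
Require Import Defs.
From HB Require Import structures.
From mathcomp Require Import all_boot all_order all_algebra.
From mathcomp Require Import all_classical all_reals all_analysis.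
From mathcomp Require Import measurable_realfun ring lra zify.

(** Divide y_N by a norm of it in C^M, M = max(n, m), and let b be a limit of
the normalizing factors along an ultrafilter.  If the normalized polynomials are
bounded with one derivative more than the problem involves, they converge in C^M
to a solution of the problem with f and the d_i multiplied by b.  Uniqueness
excludes b = 0, since this would produce a nonzero solution of the homogeneous
problem, and for b > 0 it identifies the limit of y_N with y.

The bounds come from the residual D = L y_N - h, with L = sum_i a_i d^i/dt^i and
h a polynomial approximation of g = f + int_0^1 k(.,s) D^alpha y_N(s) ds.  As g
is as smooth as f and k, Jackson's inequality makes h - g and its first
derivatives O(N^-s) for a large s.  The discrete equations say that D is almost
orthogonal to the polynomials of degree at most N - n, and D is close to them
because the terms y_N^(i), i < n, of L y_N are smooth up to primitives of D.
Hence D is O(N^-s) in L^2, and Markov's inequality turns this into bounds for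
its derivatives in the supremum norm; this is what controls D^alpha y_N when
m > n.  All the orders of approximation may be crude powers of N, since the
smoothness r is ours to choose. *)

Set Implicit Arguments.
Unset Strict Implicit.
Unset Printing Implicit Defensive.

Import Order.TTheory GRing.Theory Num.Theory.
Import numFieldNormedType.Exports.

Local Open Scope classical_set_scope.
Local Open Scope ring_scope.

(** * Primitives of polynomials and Bernstein approximation *)

(** Nothing is known about the stability of the discrete problem, so there is no a priori bound on
    y_N; normalization replaces it, and all estimates concern polynomials whose derivatives up to
    order M are at most 1. The leading term of the residual already has degree at most N - n, so
    only the terms of order below n must be approximated by test polynomials. Their approximation
    involves the unknown D again, which looks circular. The way out: a primitive of D is Holder
    continuous of exponent 1/2 with the L^2 norm of D as constant, so Bernstein polynomials of
    degree about N/2 leave a factor N^(-1/4), and this part is absorbed for large N. The other part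
    starts from the mere bound 1 and gains N^(-1/2) at each of s integrations, so s can be as large
    as Markov's inequality demands. The ultrafilter provides the limits of the normalizing factors
    and of all derivatives at all points at once, without successive subsequences. *)

Section primitive.
Context {R : realType}.
Implicit Types (p q : {poly R}) (x y : R).

(* The coefficient of degree 0 is p`_0 / 0 = 0. *)
Definition prim p : {poly R} := \poly_(i < (size p).+1) (p`_i.-1 / i%:R).

Lemma coef_prim p i : (prim p)`_i = p`_i.-1 / i%:R.
Proof.
rewrite coef_poly; case: ltnP => // ip.
by rewrite nth_default ?mul0r// -ltnS (leq_trans ip)// leqSpred.
Qed.

Lemma prim_is_linear : linear prim.
Proof.
move=> c p q; apply/polyP => i.
by rewrite coefD coefZ !coef_prim coefD coefZ; ring.
Qed.

HB.instance Definition _ :=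
  GRing.isLinear.Build R {poly R} {poly R} _ prim prim_is_linear.

Lemma deriv_prim p : (prim p)^`() = p.
Proof.
apply/polyP => i; rewrite coef_deriv coef_prim/=.
by rewrite -[LHS]mulr_natr mulfVK// pnatr_eq0.
Qed.

Lemma size_prim p : (size (prim p) <= (size p).+1)%N.
Proof. exact: size_poly. Qed.

Lemma prim0 p : (prim p).[0] = 0.
Proof. by rewrite horner_coef0 coef_prim invr0 mulr0. Qed.

Lemma prim_deriv p : prim p^`() = p - (p.[0])%:P.
Proof.
apply/polyP => -[|i]; rewrite coef_prim coefB coefC/=.
  by rewrite invr0 mulr0 horner_coef0 subrr.
by rewrite coef_deriv -[X in X / _]mulr_natr mulfK ?subr0// pnatr_eq0.
Qed.

Lemma poly_monotone p : (forall x, 0 <= x <= 1 -> 0 <= p^`().[x]) ->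
  forall x y, 0 <= x -> x <= y -> y <= 1 -> p.[x] <= p.[y].
Proof.
move=> p0 x y x0 xy y1.
have := @MVT_segment R (horner p) (horner p^`()) x y xy.
case=> [|z].
  by apply: continuous_subspaceT; exact: continuous_horner.
rewrite in_itv/= => /andP[xz zy] e.
rewrite -subr_ge0 e mulr_ge0 ?subr_ge0// p0//.
by rewrite (le_trans x0)// (le_trans zy).
Qed.

(** The integral over [0,1] taken algebraically, which keeps the estimates for polynomials free of
    measure theory; [Rintegral_pint] makes the link. *)
Definition pint p : R := (prim p).[1].

Lemma pintD p q : pint (p + q) = pint p + pint q.
Proof. by rewrite /pint linearD hornerD. Qed.

Lemma pintB p q : pint (p - q) = pint p - pint q.
Proof. by rewrite /pint linearB !hornerE. Qed.

Lemma pintZ c p : pint (c *: p) = c * pint p.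
Proof. by rewrite /pint linearZ hornerZ. Qed.

Lemma pint_sum I (r : seq I) (P : pred I) (F : I -> {poly R}) :
  pint (\sum_(i <- r | P i) F i) = \sum_(i <- r | P i) pint (F i).
Proof. by rewrite /pint linear_sum horner_sum. Qed.

Lemma pint_ge0 p : (forall x, 0 <= x <= 1 -> 0 <= p.[x]) -> 0 <= pint p.
Proof.
move=> p0; rewrite /pint -(prim0 p); apply: poly_monotone => //.
by rewrite deriv_prim.
Qed.

Lemma le_pint p q : (forall x, 0 <= x <= 1 -> p.[x] <= q.[x]) ->
  pint p <= pint q.
Proof.
move=> pq; rewrite -subr_ge0 -pintB; apply: pint_ge0 => x /pq.
by rewrite !hornerE subr_ge0.
Qed.

Lemma pintC c : pint c%:P = c.
Proof.
have e : prim c%:P = c *: 'X.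
  apply/polyP => -[|[|i]]; rewrite coef_prim coefZ coefX coefC/=; first by rewrite invr0 !mulr0.
    by rewrite divr1 mulr1.
  by rewrite mul0r mulr0.
by rewrite /pint e !hornerE.
Qed.

Definition nrm2 p : R := pint (p ^+ 2).

Lemma nrm2_ge0 p : 0 <= nrm2 p.
Proof. by apply: pint_ge0 => x _; rewrite hornerE sqr_ge0. Qed.

Lemma nrm2Z c p : nrm2 (c *: p) = c ^+ 2 * nrm2 p.
Proof. by rewrite /nrm2 exprZn pintZ. Qed.

(* The weighted AM-GM form of the Cauchy-Schwarz inequality. *)
Lemma prim_incr p (l : R) x y : 0 <= x -> x <= y -> y <= 1 ->
  2 * l * `|(prim p).[y] - (prim p).[x]| <= l ^+ 2 * (y - x) + nrm2 p.
Proof.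
move=> x0 xy y1.
have [le01 ge01] : (prim (p ^+ 2)).[y] <= nrm2 p /\ 0 <= (prim (p ^+ 2)).[x].
  have pos t : 0 <= t <= 1 -> 0 <= ((prim (p ^+ 2))^`()).[t].
    by rewrite deriv_prim hornerE sqr_ge0.
  split; last by rewrite -(prim0 (p ^+ 2)) poly_monotone// (le_trans xy).
  by apply: poly_monotone => //; apply: le_trans xy.
suff H (s : R) : s ^+ 2 = 1 -> 2 * l * (s * ((prim p).[y] - (prim p).[x])) <=
    l ^+ 2 * (y - x) + nrm2 p.
  have [h|h] := ler0P ((prim p).[y] - (prim p).[x]).
    by rewrite -mulN1r; apply: H; rewrite sqrrN expr1n.
  by rewrite -[_ - _]mul1r; apply: H; rewrite expr1n.
move=> s2.
(* The derivative of this polynomial is the square of [p - l * s]. *)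
have H := @poly_monotone (prim (p ^+ 2) + l ^+ 2 *: 'X - (2 * l * s) *: prim p) _ x y x0 xy y1.
rewrite !hornerE in H; suff H2 : (prim (p ^+ 2)).[x] + l ^+ 2 * x - 2 * l * s * (prim p).[x] <=
     (prim (p ^+ 2)).[y] + l ^+ 2 * y - 2 * l * s * (prim p).[y].
  by lra.
apply: H => t _;  rewrite derivB derivD !derivZ derivX !deriv_prim !hornerE.
suff -> : p.[t] ^+ 2 + l ^+ 2 - 2 * l * s * p.[t] = (p.[t] - l * s) ^+ 2 by exact: sqr_ge0.
have -> : l ^+ 2 = (l * s) ^+ 2 by rewrite exprMn s2 mulr1.
ring.
Qed.

End primitive.

Section bernstein.
Context {R : realType}.
Implicit Types (F G : nat -> R) (x : R).

(* The Bernstein polynomial with the sample F k at k / N: splitting off one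
   Bernoulli trial gives this recursion, so no binomial coefficient occurs. *)
Fixpoint bern (N : nat) F : {poly R} :=
  if N is N'.+1 then (1 - 'X) * bern N' F + 'X * bern N' (F \o S)
  else (F 0)%:P.

Lemma size_bern N F : (size (bern N F) <= N.+1)%N.
Proof.
elim: N F => [|N IH] F; first by rewrite /= size_polyC leq_b1.
have sX : (size (1 - 'X : {poly R})%R <= 2)%N.
  by rewrite -size_polyN opprB -polyC1 size_XsubC.
rewrite /= (leq_trans (size_polyD _ _))// geq_max; apply/andP; split.
  by rewrite (leq_trans (size_polyMleq _ _))// -ltnS; move: (IH F); lia.
by rewrite (leq_trans (size_polyMleq _ _))// size_polyX; move: (IH (F \o S)); lia.
Qed.

Lemma bernS N F x :
  (bern N.+1 F).[x] = (1 - x) * (bern N F).[x] + x * (bern N (F \o S)).[x].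
Proof. by rewrite /= !hornerE. Qed.

Lemma le_bern N F G x : 0 <= x <= 1 -> (forall k, (k <= N)%N -> F k <= G k) ->
  (bern N F).[x] <= (bern N G).[x].
Proof.
move=> /andP[x0 x1]; elim: N F G => [|N IH] F G FG.
  by rewrite /= !hornerE FG.
rewrite !bernS lerD// ler_wpM2l ?subr_ge0// IH// => k kN; apply: FG => //.
exact: leqW.
Qed.

Lemma bernD N F G x :
  (bern N (fun k => F k + G k)).[x] = (bern N F).[x] + (bern N G).[x].
Proof.
elim: N F G => [|N IH] F G; first by rewrite /= !hornerE.
by rewrite !bernS IH (IH (F \o S) (G \o S)); ring.
Qed.

Lemma bernZ N c F x : (bern N (fun k => c * F k)).[x] = c * (bern N F).[x].
Proof.
elim: N F => [|N IH] F; first by rewrite /= !hornerE.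
by rewrite !bernS IH (IH (F \o S)); ring.
Qed.

Lemma bernC N c x : (bern N (fun=> c)).[x] = c.
Proof.
elim: N => [|N IH]; first by rewrite /= !hornerE.
rewrite bernS [(fun=> c) \o S](_ : _ = fun=> c)// IH; ring.
Qed.

(** Second moment of the binomial law. The centre [c] is arbitrary because splitting off one trial
    moves it to [c - 1]. *)
Lemma bern_variance N x c : (bern N (fun k => (k%:R - c) ^+ 2)).[x] =
  (N%:R * x - c) ^+ 2 + N%:R * x * (1 - x).
Proof.
elim: N c => [|N IH] c; first by rewrite /= !hornerE; ring.
rewrite bernS IH.
rewrite [_ \o S](_ : _ = fun k => (k%:R - (c - 1)) ^+ 2).
  by rewrite IH -natr1; ring.
by apply/funext => k /=; rewrite -natr1; congr (_ ^+ 2); ring.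
Qed.

(** Positivity ([le_bern]) carries the quadratic bound over to the mean, where the variance x(1 -
    x)/N is at most 1/N. *)
Lemma bern_approx N (f : R -> R) (A B : R) x : (0 < N)%N -> 0 <= x <= 1 -> 0 <= B ->
  (forall t, 0 <= t <= 1 -> `|f t - f x| <= A + B * (t - x) ^+ 2) ->
  `|(bern N (fun k => f (k%:R / N%:R))).[x] - f x| <= A + B / N%:R.
Proof.
move=> N0 x01 B0 fx.
have N0' : (0 : R) < N%:R by rewrite ltr0n.
pose G k := A + B / N%:R ^+ 2 * ((k%:R : R) - N%:R * x) ^+ 2.
have FG k : (k <= N)%N -> `|f (k%:R / N%:R) - f x| <= G k.
  move=> kN; apply: le_trans (fx _ _) _.
    by rewrite divr_ge0//= ler_pdivrMr// mul1r ler_nat.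
  by rewrite /G le_eqVlt; apply/orP; left; apply/eqP; field; rewrite gt_eqF.
have GE : (bern N G).[x] <= A + B / N%:R.
  rewrite /G bernD bernC bernZ bern_variance lerD2l subrr expr0n/= add0r.
  have -> : B / N%:R ^+ 2 * (N%:R * x * (1 - x)) = B / N%:R * (x * (1 - x)).
    by field; rewrite gt_eqF.
  by rewrite ler_piMr ?divr_ge0 ?(ltW N0')//; nra.
rewrite ler_norml; apply/andP; split.
  have : (bern N (fun k => f x - G k)).[x] <= (bern N (fun k => f (k%:R / N%:R))).[x].
    by apply: le_bern => // k /FG; rewrite ler_norml; lra.
  have -> : (bern N (fun k => f x - G k)).[x] = f x - (bern N G).[x].
    rewrite -(bernC N (f x) x) -[- _]mulN1r -bernZ -bernD.
    by congr (bern _ _).[_]; apply/funext => k; rewrite mulN1r bernC.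
  lra.
have : (bern N (fun k => f (k%:R / N%:R))).[x] <= (bern N (fun k => f x + G k)).[x].
  by apply: le_bern => // k /FG; rewrite ler_norml; lra.
rewrite bernD bernC; lra.
Qed.

(* lam stands for 1 / sqrt N, the root of the variance of the Bernstein
   weights. *)
Lemma bern_lipschitz N (lam : R) (f : R -> R) (L x : R) :
  0 < lam -> lam ^+ 2 * N%:R = 1 -> 0 <= x <= 1 -> 0 <= L ->
  (forall t, 0 <= t <= 1 -> `|f t - f x| <= L * `|t - x|) ->
  `|(bern N (fun k => f (k%:R / N%:R))).[x] - f x| <= 2 * lam * L.
Proof.
move=> l0 lN x01 L0 fx.
have N0 : (0 < N)%N by case: N lN => // /eqP; rewrite mulr0 eq_sym oner_eq0.
have N0' : (N%:R : R) != 0 by rewrite pnatr_eq0 -lt0n.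
(* AM-GM in the form |t - x| <= lam + (t - x)^2 / lam; as 1/N is lam^2, both terms contribute
   [L * lam]. *)
have -> : 2 * lam * L = L * lam + (L / lam) / N%:R.
  have -> : (N%:R : R)^-1 = lam ^+ 2 by apply: (mulIf N0'); rewrite mulVf.
  by field; rewrite gt_eqF.
apply: bern_approx => //; first by rewrite divr_ge0// ltW.
move=> t /fx/le_trans; apply.
rewrite -mulrA -mulrDr ler_wpM2l// -(ler_pM2l l0) mulrDr mulVKf ?gt_eqF//.
rewrite -real_normK ?num_real//; nra.
Qed.

(* The hypothesis on f is |f t - f x| <= L |t - x|^(1/2), with the square root
   removed by AM-GM. *)
Lemma bern_holder N (lam : R) (f : R -> R) (L x : R) :
  0 < lam -> lam ^+ 4 * N%:R = 1 -> 0 <= x <= 1 -> 0 <= L ->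
  (forall t l, 0 <= t <= 1 -> 0 < l -> 2 * l * `|f t - f x| <= l ^+ 2 * `|t - x| + L ^+ 2) ->
  `|(bern N (fun k => f (k%:R / N%:R))).[x] - f x| <= 2 * lam * L.
Proof.
move=> l0 lN x01 L0 fx.
have N0 : (0 < N)%N by case: N lN => // /eqP; rewrite mulr0 eq_sym oner_eq0.
have N0' : (N%:R : R) != 0 by rewrite pnatr_eq0 -lt0n.
have -> : 2 * lam * L = L * lam + (L / lam ^+ 3) / N%:R.
  have -> : (N%:R : R)^-1 = lam ^+ 4 by apply: (mulIf N0'); rewrite mulVf.
  by field; rewrite gt_eqF.
apply: bern_approx => //; first by rewrite divr_ge0// exprn_ge0// ltW.
(* For [L = 0] the parameter [L / lam] used below is not positive. Taking [l] equal to the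
   difference d itself gives 2 d^2 <= d^2 |t - x| with |t - x| <= 1, hence d = 0. *)
move=> t t01; move: L0; rewrite le_eqVlt => /predU1P[L0|L0].
  rewrite -L0 !mul0r add0r leNgt; apply/negP => d0.
  have := fx t _ t01 d0; rewrite -L0 expr0n addr0.
  have : `|t - x| <= 1 by rewrite ler_norml; lra.
  set d := `|f t - f x| in d0 *; set h := `|t - x|; nra.
(* With u = |t - x| / lam^2 this choice of [l] gives 2 d <= L lam (u + 1), and u + 1 <= 2 (1 + u^2)
   has the quadratic form required. *)
have := fx t (L / lam) t01 (divr_gt0 L0 l0).
have -> : (t - x) ^+ 2 = `|t - x| ^+ 2 by rewrite real_normK ?num_real.
set d := `|f t - f x|; set h := `|t - x| => H.
have {}H : 2 * d <= L * (h / lam + lam).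
  rewrite -(ler_pM2l (divr_gt0 L0 l0)).
  have -> : L / lam * (L * (h / lam + lam)) = (L / lam) ^+ 2 * h + L ^+ 2.
    by field; rewrite gt_eqF.
  by apply: le_trans H; rewrite mulrCA mulrA.
suff : L * (h / lam + lam) <= 2 * (L * lam + L / lam ^+ 3 * h ^+ 2) by lra.
have -> : h / lam + lam = lam * (h / lam ^+ 2 + 1) by field; rewrite gt_eqF.
have -> : L * lam + L / lam ^+ 3 * h ^+ 2 = L * lam * (1 + (h / lam ^+ 2) ^+ 2).
  by field; rewrite gt_eqF.
rewrite mulrA [2 * _]mulrCA ler_wpM2l ?mulr_ge0 ?ltW//; nra.
Qed.

End bernstein.

(** * Chebyshev interpolation and Markov's inequality *)

Section chebyshev.
Context {R : realType}.
Implicit Types (p q : {poly R}) (x y c : R).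

Lemma coef_size_neq0 p k : size p = k.+1 -> p`_k != 0.
Proof.
by move=> sp; rewrite -[k]/(k.+1.-1) -sp -lead_coefE lead_coef_eq0 -size_poly_eq0 sp.
Qed.

(** Only the degrees matter, so the Chebyshev and the Legendre bases are both covered; the induction
    removes the leading term. *)
Lemma poly_span (P : nat -> {poly R}) n p :
  (forall k, (k <= n)%N -> size (P k) = k.+1) -> (size p <= n.+1)%N ->
  exists c : nat -> R, p = \sum_(k < n.+1) c k *: P k.
Proof.
elim: n p => [|n IH] p sP sp.
  have P0 := coef_size_neq0 (sP 0 (leqnn 0)).
  exists (fun=> p`_0 / (P 0)`_0); rewrite big_ord1; apply/polyP => -[|i].
    by rewrite coefZ divfK.
  rewrite coefZ [(P 0)`_i.+1]nth_default ?(sP _ (leqnn 0))// mulr0 nth_default//.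
  exact: leq_trans sp _.
have Pn := coef_size_neq0 (sP _ (leqnn n.+1)).
pose e := p`_n.+1 / (P n.+1)`_n.+1.
have [|d dE] := IH (p - e *: P n.+1) (fun k kn => sP _ (leqW kn)).
  apply/leq_sizeP => j; rewrite leq_eqVlt => /predU1P[<-|nj].
    by rewrite coefB coefZ divfK ?subrr.
  by rewrite coefB coefZ !nth_default ?mulr0 ?subrr// ?sP// (leq_trans sp).
exists (fun k => if k == n.+1 then e else d k).
rewrite big_ord_recr/= eqxx -[LHS](subrK (e *: P n.+1)) dE; congr (_ + _).
by apply: eq_bigr => k _; rewrite ltn_eqF.
Qed.

(* (T_k, U_{k-1}), the polynomials with T_k(cos t) = cos (k t) and
   U_{k-1}(cos t) sin t = sin (k t), by the addition formulas. *)
Fixpoint chebTU (k : nat) : {poly R} * {poly R} :=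
  if k is k'.+1 then
    let: (T, U) := chebTU k' in ('X * T - (1 - 'X^2) * U, 'X * U + T)
  else (1, 0).

Definition chebT k := (chebTU k).1.
Definition chebU k := (chebTU k).2.

Lemma chebTS k : chebT k.+1 = 'X * chebT k - (1 - 'X^2) * chebU k.
Proof. by rewrite /chebT /chebU /=; case: chebTU. Qed.

Lemma chebUS k : chebU k.+1 = 'X * chebU k + chebT k.
Proof. by rewrite /chebT /chebU /=; case: chebTU. Qed.

(** The second identity closes the induction: differentiating [chebTS] produces [(1 - 'X^2)] times
    the derivative of U, which must be expressed through T and U again. *)
Lemma deriv_cheb k : (chebT k)^`() = k%:R *: chebU k /\
  (1 - 'X^2) * (chebU k)^`() = 'X * chebU k - k%:R *: chebT k.
Proof.
elim: k => [|k [IHT IHU]].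
  rewrite /chebT /chebU /= scaler0 deriv0 !mulr0 scale0r subrr.
  by rewrite -polyC1 derivC.
rewrite chebTS chebUS -natr1 !(derivB, derivD, derivM, derivX, derivXn) derivC IHT.
rewrite -!mul_polyC in IHT IHU *; rewrite polyCD.
set T := chebT k in IHT IHU *; set U := chebU k in IHT IHU *; set n := k%:R%:P in IHT IHU *.
clearbody T U n; split.
  rewrite polyC1 [X in X *+ 2](_ : _ = 'X)// mulr2n IHU.
  ring.
transitivity ((n + 1) * ((1 - 'X^2) * U) + 'X * ((1 - 'X^2) * U^`())); first by ring.
by rewrite IHU polyC1; ring.
Qed.

Lemma cheb_cos k (t : R) :
  (chebT k).[cos t] = cos (k%:R * t) /\
  (chebU k).[cos t] * sin t = sin (k%:R * t).
Proof.
elim: k => [|k [IHT IHU]]; first by rewrite /chebT /chebU /= !hornerE cos0 sin0.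
have -> : k.+1%:R * t = k%:R * t + t by rewrite -natr1; ring.
rewrite chebTS chebUS cosD sinD -IHT -IHU !hornerE; split.
  have := cos2Dsin2 t; set s := sin t => e.
  rewrite (_ : 1 - cos t ^+ 2 = s ^+ 2); last by rewrite -e; ring.
  ring.
ring.
Qed.

Lemma chebT_le1 k x : -1 <= x <= 1 -> `|(chebT k).[x]| <= 1.
Proof.
move=> x1; rewrite -(acosK (x := x)) ?in_itv// (cheb_cos _ _).1.
by rewrite ler_norml cos_geN1 cos_le1.
Qed.

Lemma chebU_le k x : -1 <= x <= 1 -> `|(chebU k).[x]| <= k%:R.
Proof.
move=> x1; elim: k => [|k IH]; first by rewrite /chebU /= horner0 normr0.
rewrite chebUS !hornerE (le_trans (ler_normD _ _))// -natr1 lerD ?chebT_le1//.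
by rewrite normrM (le_trans _ IH)// ler_piMl// ler_norml.
Qed.

Lemma chebT_rec k : chebT k.+2 = 2%:R *: ('X * chebT k.+1) - chebT k.
Proof. by rewrite 2!chebTS chebUS scaler_nat; ring. Qed.

Lemma size_chebT k : size (chebT k) = k.+1.
Proof.
suff : size (chebT k) = k.+1 /\ size (chebT k.+1) = k.+2 by case.
elim: k => [|k [IH1 IH2]].
  by rewrite chebTS /chebT /chebU/= mulr1 mulr0 subr0 size_poly1 size_polyX.
split=> //; rewrite chebT_rec.
have s2 : size (2%:R *: ('X * chebT k.+1)) = k.+3.
  by rewrite size_scale ?pnatr_eq0// mulrC size_mulX ?IH2// -size_poly_eq0 IH2.
by rewrite size_polyDl// s2 size_polyN IH1.
Qed.

Definition cheb_angle (N j : nat) : R := (2 * j + 1)%:R * pi / (2 * N + 2)%:R.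

Lemma cheb_nodeE N j : 1 - 2 * cheb_node N j = cos (cheb_angle N j).
Proof. by rewrite /cheb_node /cheb_angle mulVKf ?pnatr_eq0//; ring. Qed.

(** Multiplied by 2 sin h, with h = k pi / (2N + 2), the sum telescopes to sin(k pi) = 0; the bounds
    on [k] put h strictly between 0 and pi, where sin h is nonzero. *)
Lemma sum_cos_angle N k : (0 < k < 2 * N + 2)%N ->
  \sum_(j < N.+1) cos (k%:R * cheb_angle N j) = 0.
Proof.
move=> /andP[k0 kN]; pose h : R := k%:R * pi / (2 * N + 2)%:R.
have N0 : ((2 * N + 2)%:R : R) != 0 by rewrite pnatr_eq0; lia.
have sh : 0 < sin h.
  have pi0 := pi_gt0 R.
  apply: sin_gt0_pi; apply/andP; split.
    by rewrite divr_gt0 ?mulr_gt0 ?ltr0n//; lia.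
  by rewrite ltr_pdivrMr ?ltr0n; [rewrite mulrC ltr_pM2l// ltr_nat | lia].
have sin_npi n : sin (n%:R * pi : R) = 0.
  by elim: n => [|n IH]; rewrite ?mul0r ?sin0// -natr1 mulrDl mul1r sinDpi IH oppr0.
apply: (mulfI (lt0r_neq0 sh)); rewrite mulr0; have n2 : (2 : R) != 0 by rewrite pnatr_eq0.
apply: (mulfI n2).
rewrite mulr0 mulr_sumr mulr_sumr.
transitivity (\sum_(0 <= j < N.+1) (sin ((2 * j.+1)%:R * h) - sin ((2 * j)%:R * h))).
  rewrite big_mkord; apply: eq_bigr => j _.
  have [u [-> -> ->]] : exists u, [/\ k%:R * cheb_angle N j = u,
      (2 * j.+1)%:R * h = u + h & (2 * j)%:R * h = u - h].
    exists ((2 * j)%:R * h + h); rewrite mulnS !natrD /cheb_angle /h natrD.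
    by split; ring.
  by rewrite sinD sinB; ring.
rewrite telescope_sumr// muln0 mul0r sin0 subr0.
have -> : (2 * N.+1)%:R * h = k%:R * pi.
  by rewrite /h mulnS addnC; field.
exact: sin_npi.
Qed.

(** Product-to-sum formula: k + m <= 2N stays below 2N + 2, so [sum_cos_angle] kills every frequency
    except 0. *)
Lemma cos_angle_orth N k m : (k <= N)%N -> (m <= N)%N ->
  \sum_(j < N.+1) cos (k%:R * cheb_angle N j) * cos (m%:R * cheb_angle N j) =
  (k == m)%:R * (if m == 0 then 1 else 2^-1) * N.+1%:R.
Proof.
wlog km : k m / (m <= k)%N => [H kN mN|kN mN].
  have [mk|/ltnW km] := leqP m k; first exact: H.
  under eq_bigr do rewrite mulrC.
  by rewrite H// eq_sym; have [->|] := eqVneq k m; rewrite ?mul0r.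
have -> : \sum_(j < N.+1) cos (k%:R * cheb_angle N j) * cos (m%:R * cheb_angle N j) =
  2^-1 * (\sum_(j < N.+1) cos ((k + m)%:R * cheb_angle N j) +
          \sum_(j < N.+1) cos ((k - m)%:R * cheb_angle N j)).
  rewrite -big_split mulr_sumr; apply: eq_bigr => j _.
  by rewrite natrD natrB// mulrDl mulrBl cosD cosB /=; field.
have cos0s : \sum_(j < N.+1) cos (0%:R * cheb_angle N j) = N.+1%:R :> R.
  under eq_bigr do rewrite mul0r cos0.
  by rewrite sumr_const card_ord.
have [->|km'] := eqVneq k m.
  rewrite subnn cos0s mul1r; have [->|m0] := eqVneq m 0%N.
    by rewrite cos0s; field.
  by rewrite sum_cos_angle ?add0r//; lia.
rewrite !sum_cos_angle ?addr0 ?mulr0 ?mul0r//; lia.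
Qed.

(** Reverses the orientation, so that node [j] goes to the cosine of angle [j] without
    reindexing. *)
Definition flip : {poly R} := 1 - 2%:R *: 'X.

Lemma horner_flip p x : (p \Po flip).[x] = p.[1 - 2 * x].
Proof. by rewrite horner_comp /flip !hornerE. Qed.

Lemma size_flip : size flip = 2%N.
Proof.
rewrite /flip -size_polyN opprB size_polyDl size_scale ?pnatr_eq0// size_polyX//.
by rewrite size_polyN size_poly1.
Qed.

(** Discrete orthogonality gives each coefficient as 1 or 2 times the mean of the node values
    against a cosine. [cheb_lebesgue] and [poly_markov] are both read off from this expansion. *)
Lemma cheb_expand N p (B : R) : (size p <= N.+1)%N ->
  (forall j, (j <= N)%N -> `|p.[cheb_node N j]| <= B) ->
  exists2 c : nat -> R, p = \sum_(k < N.+1) c k *: (chebT k \Po flip) &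
    forall k, (k <= N)%N -> `|c k| <= 2 * B.
Proof.
move=> sp pB.
have [|c pE] := @poly_span (fun k => chebT k \Po flip) N p _ sp.
  by move=> k _; rewrite size_comp_poly2 ?size_flip// size_chebT.
exists c => // m mN.
have N0 : (0 : R) < N.+1%:R by rewrite ltr0n.
have pnode j : p.[cheb_node N j] = \sum_(k < N.+1) c k * cos (k%:R * cheb_angle N j).
  rewrite pE horner_sum; apply: eq_bigr => k _.
  by rewrite hornerZ horner_flip cheb_nodeE (cheb_cos _ _).1.
have e : \sum_(j < N.+1) p.[cheb_node N j] * cos (m%:R * cheb_angle N j) =
    c m * (if m == 0 then 1 else 2^-1) * N.+1%:R.
  under eq_bigr do rewrite pnode mulr_suml.
  rewrite exchange_big/= (bigD1 (Ordinal (mN : m < N.+1)%N))//= [X in _ + X]big1 ?addr0.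
    under eq_bigr do rewrite -mulrA.
    by rewrite -mulr_sumr cos_angle_orth// eqxx mul1r mulrA.
  move=> k km; under eq_bigr do rewrite -mulrA.
  rewrite -mulr_sumr cos_angle_orth//; last by rewrite -ltnS.
  case: eqP => [k_m|]; last by rewrite !mul0r mulr0.
  by case/eqP: km; apply: val_inj.
have le : `|c m * (if m == 0 then 1 else 2^-1) * N.+1%:R| <= B * N.+1%:R.
  rewrite -e (le_trans (ler_norm_sum _ _ _))//.
  rewrite [leRHS](_ : _ = \sum_(j < N.+1) B); last first.
    by rewrite sumr_const card_ord mulr_natr.
  apply: ler_sum => j _; rewrite normrM (le_trans _ (pB j _)) -1?ltnS//.
  by rewrite ler_piMr// cos_max.
move: le; rewrite normrM normr_nat ler_pM2r// normrM.
have := normr_ge0 (c m).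
by case: eqP => _; rewrite ?normr1 ?[`|2^-1|]ger0_norm ?invr_ge0//; lra.
Qed.

Lemma flip_itv x : 0 <= x <= 1 -> -1 <= 1 - 2 * x <= 1.
Proof. by lra. Qed.

Lemma cheb_lebesgue N p (B : R) : (size p <= N.+1)%N ->
  (forall j, (j <= N)%N -> `|p.[cheb_node N j]| <= B) ->
  forall x, 0 <= x <= 1 -> `|p.[x]| <= 2 * N.+1%:R * B.
Proof.
move=> sp pB x x01; have [c -> cB] := cheb_expand sp pB.
rewrite horner_sum (le_trans (ler_norm_sum _ _ _))//.
rewrite [leRHS](_ : _ = \sum_(j < N.+1) (2 * B)); last first.
  by rewrite sumr_const card_ord -[RHS]mulr_natr; ring.
apply: ler_sum => k _; rewrite hornerZ normrM horner_flip.
rewrite (le_trans _ (cB k _)) -1?ltnS// ler_piMr//.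
exact/chebT_le1/flip_itv.
Qed.

Lemma cheb_node01 N j : 0 <= (cheb_node N j : R) <= 1.
Proof.
have := cos_le1 (cheb_angle N j); have := cos_geN1 (cheb_angle N j).
by rewrite -cheb_nodeE; lra.
Qed.

(** Termwise: N + 1 terms, coefficients at most 2B, and T_k' = k U_{k-1} at most k^2, doubled by
    [flip]. *)
Lemma poly_markov N p (B : R) : (size p <= N.+1)%N ->
  (forall x, 0 <= x <= 1 -> `|p.[x]| <= B) ->
  forall x, 0 <= x <= 1 -> `|p^`().[x]| <= 4 * N.+1%:R ^+ 3 * B.
Proof.
move=> sp pB x x01.
have [c -> cB] := cheb_expand sp (fun j _ => pB _ (cheb_node01 N j)).
rewrite raddf_sum horner_sum (le_trans (ler_norm_sum _ _ _))//.
rewrite [leRHS](_ : _ = \sum_(j < N.+1) (4 * N.+1%:R ^+ 2 * B)); last first.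
  by rewrite sumr_const card_ord -[RHS]mulr_natr; ring.
have B0 : 0 <= B := le_trans (normr_ge0 _) (pB x x01).
apply: ler_sum => k _; rewrite /= derivZ hornerZ deriv_comp.
have -> : flip^`() = (- 2)%:P :> {poly R}.
  by rewrite /flip derivB derivZ derivX -polyC1 derivC sub0r -mul_polyC -polyCM mulr1 polyCN.
rewrite (deriv_cheb k).1 hornerM hornerC horner_flip hornerZ !normrM normrN !normr_nat.
have c1 := cB k (ltn_ord k : (k <= N)%N).
have c2 := chebU_le k (flip_itv x01).
have k1 : (k%:R : R) <= N.+1%:R by rewrite ler_nat ltnW.
rewrite [leRHS](_ : _ = 2 * B * (N.+1%:R * N.+1%:R * 2)); last by ring.
rewrite ler_pM ?mulr_ge0// ler_wpM2r// ler_pM//.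
exact: le_trans c2 k1.
Qed.

(** Markov's inequality for the primitive, which [prim_incr] bounds by [l]; its degree is one
    higher, hence [N.+2]. *)
Lemma nrm2_markov N p (l : R) : (size p <= N.+1)%N -> 0 < l -> nrm2 p <= l ^+ 2 ->
  forall x, 0 <= x <= 1 -> `|p.[x]| <= 4 * N.+2%:R ^+ 3 * l.
Proof.
move=> sp l0 pl x x01; rewrite -(deriv_prim p).
apply: (poly_markov _ _ x01); first exact: leq_trans (size_prim _) _.
move=> y /andP[y0 y1]; have := prim_incr p l (lexx 0) y0 y1.
rewrite prim0 !subr0 => H.
rewrite -(ler_pM2l l0) -(ler_pM2l (ltr0n R 2)) mulrA (le_trans H)//; nra.
Qed.

End chebyshev.

(** * The residual in the mean *)

Section residual.
Context {R : realType}.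
Implicit Types (p q h D : {poly R}) (x y c : R).

Lemma poly_lipschitz p (L : R) : (forall x, 0 <= x <= 1 -> `|p^`().[x]| <= L) ->
  forall x y, 0 <= x <= 1 -> 0 <= y <= 1 -> `|p.[y] - p.[x]| <= L * `|y - x|.
Proof.
move=> pL; suff H x y : 0 <= x -> x <= y -> y <= 1 -> `|p.[y] - p.[x]| <= L * `|y - x|.
  move=> x y /andP[x0 x1] /andP[y0 y1]; have [xy|/ltW yx] := leP x y; first exact: H.
  by rewrite distrC [`|y - x|]distrC H.
move=> x0 xy y1; rewrite [`|y - x|]ger0_norm ?subr_ge0// ler_norml.
have H1 := @poly_monotone _ (L *: 'X - p) _ x y x0 xy y1.
have H2 := @poly_monotone _ (L *: 'X + p) _ x y x0 xy y1.
move: H1 H2; rewrite derivB derivD derivZ derivX => H1 H2.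
have {}H1 : L * x - p.[x] <= L * y - p.[y].
  move: H1; rewrite !hornerE; apply=> t /pL.
  by rewrite !hornerE ler_norml; lra.
have {}H2 : L * x + p.[x] <= L * y + p.[y].
  move: H2; rewrite !hornerE; apply=> t /pL.
  by rewrite !hornerE ler_norml; lra.
by apply/andP; split; lra.
Qed.

Lemma nrm2D p q : nrm2 (p + q) <= 2 * nrm2 p + 2 * nrm2 q.
Proof.
rewrite /nrm2 -!pintZ -pintD; apply: le_pint => x _; rewrite !(horner_exp, hornerD, hornerZ).
by have := sqr_ge0 (p.[x] - q.[x]); nra.
Qed.

Lemma nrm2_sum n (F : nat -> {poly R}) (M : R) :
  (forall i, (i < n)%N -> nrm2 (F i) <= M) -> 0 <= M ->
  nrm2 (\sum_(i < n) F i) <= 4 ^+ n * M.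
Proof.
move=> FM M0; elim: n FM => [|n IH] FM.
  by rewrite big_ord0 expr0 mul1r /nrm2 expr0n/= /pint linear0 horner0.
rewrite big_ord_recr/= (le_trans (nrm2D _ _))//.
have := IH (fun i ni => FM i (leqW ni)); have := FM n (ltnSn n).
have : 1 <= 4 ^+ n :> R by rewrite exprn_ege1// ler1n.
rewrite exprS; nra.
Qed.

Lemma sqr_prim_le p x : 0 <= x <= 1 -> (prim p).[x] ^+ 2 <= nrm2 p.
Proof.
move=> /andP[x0 x1]; have := prim_incr p (`|(prim p).[x]|) (lexx 0) x0 x1.
rewrite prim0 !subr0 real_normK ?num_real// -[_ * `|_| * _]mulrA -expr2.
by rewrite real_normK ?num_real//; have := sqr_ge0 (prim p).[x]; nra.
Qed.

Lemma nrm2_prim p : nrm2 (prim p) <= nrm2 p.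
Proof.
rewrite -[leRHS]pintC; apply: le_pint => x x01.
by rewrite hornerC hornerE sqr_prim_le.
Qed.

(** [prim_incr] is Holder continuity of exponent 1/2, with the L^2 norm as constant, in the form
    that [bern_holder] expects. *)
Lemma bern_prim_holder N (lam L : R) p : 0 < lam -> lam ^+ 4 * N%:R = 1 ->
  0 <= L -> nrm2 p <= L ^+ 2 -> forall x, 0 <= x <= 1 ->
  `|(bern N (fun k => (prim p).[k%:R / N%:R])).[x] - (prim p).[x]| <= 2 * lam * L.
Proof.
move=> l0 lN L0 pL x x01.
apply: (bern_holder (f := horner (prim p)) l0 lN x01 L0) => t l t01 l1.
have [tx|/ltW xt] := leP t x.
  rewrite distrC [`|t - x|]distrC [`|x - t|]ger0_norm ?subr_ge0//.
  by rewrite (le_trans (prim_incr _ _ _ _ _)) ?lerD2l//; lra.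
rewrite [`|t - x|]ger0_norm ?subr_ge0//.
by rewrite (le_trans (prim_incr _ _ _ _ _)) ?lerD2l//; lra.
Qed.

Definition diffop n (a : nat -> R) p : {poly R} := \sum_(i < n.+1) a i *: p^`(i).

Lemma coef_bound n (a : nat -> R) : exists A : R, forall i, (i <= n)%N -> `|a i| <= A.
Proof.
exists (\sum_(i < n.+1) `|a i|) => i; rewrite -ltnS => ni.
by rewrite (bigD1 (Ordinal ni))//= lerDl sumr_ge0.
Qed.

Lemma horner_lincomb n (a : nat -> R) (F : nat -> {poly R}) x :
  (\sum_(i < n) a i *: F i).[x] = \sum_(i < n) a i * (F i).[x].
Proof. by rewrite horner_sum; apply: eq_bigr => i _; rewrite hornerZ. Qed.

Lemma diffopE n (a : nat -> R) p :
  diffop n a p = \sum_(i < n) a i *: p^`(i) + a n *: p^`(n).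
Proof. by rewrite /diffop big_ord_recr. Qed.

Lemma sum_norm_le n (a u : nat -> R) (A M : R) :
  (forall i, (i < n)%N -> `|a i| <= A) -> (forall i, (i < n)%N -> `|u i| <= M) ->
  `|\sum_(i < n) a i * u i| <= n%:R * A * M.
Proof.
move=> aA uM; rewrite (le_trans (ler_norm_sum _ _ _))//.
rewrite [leRHS](_ : _ = \sum_(i < n) A * M).
  by apply: ler_sum => i _; rewrite normrM ler_pM// ?aA ?uM.
by rewrite sumr_const card_ord -[RHS]mulr_natr; ring.
Qed.

(* Up to an error of order lam^s, each p^(i) with i < n is a polynomial of low
   degree plus a primitive controlled by the residual D: replace p^(n) by means
   of the equation and integrate. *)
Lemma residual_split n (a : nat -> R) (s : nat) : a n != 0 ->
  exists2 C : R, 0 <= C & forall nu K (lam : R) p h,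
    0 < lam -> lam ^+ 2 * nu%:R = 1 -> (nu < K)%N -> (size h <= K)%N ->
    (forall i x, (i < n)%N -> 0 <= x <= 1 -> `|p^`(i).[x]| <= 1) ->
    forall i, (i < n)%N -> exists q t, [/\ (size q <= K + s)%N,
      nrm2 t <= C * nrm2 (diffop n a p - h) &
      forall x, 0 <= x <= 1 -> `|p^`(i).[x] - q.[x] - (prim t).[x]| <= C * lam ^+ s].
Proof.
move=> an0; have [A aA] := coef_bound n a.
elim: s => [|s [C C0 IH]].
  exists 1 => // nu K lam p h l0 ln nK sh p1 i ni; exists 0, 0; split.
  - by rewrite size_poly0.
  - by rewrite /nrm2 expr0n/= /pint linear0 horner0 mulr_ge0// nrm2_ge0.
  - by move=> x x01; rewrite linear0 horner0 !subr0 mul1r expr0 p1.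
pose A' : R := `|(a n)^-1|.
have A0 : 0 <= A := le_trans (normr_ge0 _) (aA n (leqnn n)).
have A'0 : 0 <= A' by exact: normr_ge0.
(* The last two requirements bound [t] and the error at order n, where the equation is solved for
   the leading derivative. *)
have [C1 [C1C C1X C1Y]] : exists C1, [/\ C <= C1,
    A' ^+ 2 * (2 + 2 * 4 ^+ n * (A ^+ 2 * C)) <= C1 & A' * n%:R * A * C <= C1].
  set X := A' ^+ 2 * _; set Y := A' * _ * _ * _.
  have X0 : 0 <= X by rewrite mulr_ge0 ?addr_ge0 ?mulr_ge0 ?exprn_ge0.
  have Y0 : 0 <= Y by rewrite !mulr_ge0.
  by exists (C + X + Y); split; lra.
exists (2 * C1) => [|nu K lam p h l0 ln nK sh p1 i ni].
  by rewrite mulr_ge0// (le_trans C0).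
have lam_s : 0 <= lam ^+ s by rewrite exprn_ge0 ?ltW.
set D := diffop n a p - h; have D0 := nrm2_ge0 D.
(* It is enough to split the next derivative, with [t] itself in place of its primitive: integration
   from 0 supplies the primitive, and the integrated remainder is Lipschitz with constant of order
   lam^s, so its Bernstein polynomial gains a factor lam. *)
suff [q [t [sq tD qt]]] : exists q t, [/\ (size q <= K + s)%N,
    nrm2 t <= C1 * nrm2 D & forall x, 0 <= x <= 1 ->
      `|p^`(i.+1).[x] - q.[x] - t.[x]| <= C1 * lam ^+ s].
  pose r := p^`(i.+1) - q - t.
  pose b := bern nu (fun k => (prim r).[k%:R / nu%:R]).
  exists ((p^`(i).[0])%:P + prim q + b), t; split.
  - rewrite (leq_trans (size_polyD _ _))// geq_max; apply/andP; split.
      rewrite (leq_trans (size_polyD _ _))// geq_max; apply/andP; split.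
        by rewrite (leq_trans (size_polyC_leq1 _))//; clear -nK; lia.
      by rewrite (leq_trans (size_prim _))//; clear -sq; lia.
    by rewrite (leq_trans (size_bern _ _))//; clear -nK; lia.
  - by rewrite (le_trans tD)// ler_wpM2r//; lra.
  - move=> x x01.
    have e : p^`(i).[x] = p^`(i).[0] + (prim q).[x] + (prim t).[x] + (prim r).[x].
      have := congr1 (fun u : {poly R} => u.[x]) (prim_deriv p^`(i)).
      rewrite /r !linearB/= -derivnS !(hornerD, hornerN, hornerC) => ->.
      clear; ring.
    have rl y : 0 <= y <= 1 -> `|(prim r).[y] - (prim r).[x]| <= C1 * lam ^+ s * `|y - x|.
      move=> y01; apply: poly_lipschitz => // z z01.
      by rewrite deriv_prim /r !hornerE qt.
    have L0 : 0 <= C1 * lam ^+ s by rewrite mulr_ge0// (le_trans C0).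
    have := bern_lipschitz (f := horner (prim r)) l0 ln x01 L0 rl.
    rewrite -/b distrC e !(hornerD, hornerC) exprS.
    rewrite [X in _ -> `|X| <= _](_ : _ = (prim r).[x] - b.[x]); last by ring.
    by rewrite [X in _ -> _ <= X](_ : _ = 2 * lam * (C1 * lam ^+ s)); last by ring.
have := IH nu K lam p h l0 ln nK sh p1; rewrite -/D => {}IH.
(* Below order n the induction hypothesis applies, with [prim t] as the new [t]; at order n the
   definition of D is solved for the derivative, and the hypothesis is used for all lower orders. *)
have [i1n|ni1] := ltnP i.+1 n.
  have [q [t [sq tD qt]]] := IH _ i1n; exists q, (prim t); split=> //.
    by rewrite (le_trans (nrm2_prim t))// (le_trans tD)// ler_wpM2r.
  by move=> x /qt/le_trans; apply; rewrite ler_wpM2r.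
have {ni ni1 i}-> : i.+1 = n by clear -ni ni1; lia.
have /choice[f fP] : forall i, exists qt : {poly R} * {poly R}, (i < n)%N ->
    [/\ (size qt.1 <= K + s)%N, nrm2 qt.2 <= C * nrm2 D &
      forall x, 0 <= x <= 1 ->
        `|p^`(i).[x] - qt.1.[x] - (prim qt.2).[x]| <= C * lam ^+ s].
  move=> i; have [ni|ni] := ltnP i n; last by exists (0, 0).
  by have [q [t ?]] := IH i ni; exists (q, t).
exists ((a n)^-1 *: (h - \sum_(j < n) a j *: (f j).1)),
  ((a n)^-1 *: (D - \sum_(j < n) a j *: prim (f j).2)); split.
- rewrite (leq_trans (size_scale_leq _ _))// (leq_trans (size_polyD _ _))//.
  rewrite size_polyN geq_max (leq_trans sh) ?leq_addr//=.
  rewrite (leq_trans (size_sum _ _ _))//; apply/bigmax_leqP => j _.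
  by rewrite (leq_trans (size_scale_leq _ _))//; have [] := fP j (ltn_ord j).
- rewrite nrm2Z -(real_normK (num_real _)) -/A' -scaleN1r.
  apply: (@le_trans _ _ (A' ^+ 2 * (2 * nrm2 D + 2 * (4 ^+ n * (A ^+ 2 * (C * nrm2 D)))))).
    rewrite ler_wpM2l ?exprn_ge0// (le_trans (nrm2D _ _))// lerD2l ler_wpM2l//.
    rewrite nrm2Z sqrrN expr1n mul1r.
    apply: (nrm2_sum (F := fun j => a j *: prim (f j).2)) => [j jn|]; last first.
      by rewrite !mulr_ge0 ?exprn_ge0.
    rewrite nrm2Z ler_pM ?sqr_ge0 ?nrm2_ge0//.
      by rewrite -(real_normK (num_real _)) lerXn2r ?nnegrE// aA// ltnW.
    by have [_ + _] := fP j jn; apply: le_trans; exact: nrm2_prim.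
  rewrite [leLHS](_ : _ = A' ^+ 2 * (2 + 2 * 4 ^+ n * (A ^+ 2 * C)) * nrm2 D); last by ring.
  by rewrite ler_wpM2r.
- move=> x x01.
  have -> : p^`(n) = (a n)^-1 *: (D + h - \sum_(j < n) a j *: p^`(j)).
    by rewrite /D subrK diffopE addrC addKr scalerA mulVf ?scale1r.
  rewrite !(hornerZ, hornerD, hornerN).
  set u := (X in `|X|).
  have -> : u = - ((a n)^-1 * \sum_(j < n) a j *
      (p^`(j).[x] - (f j).1.[x] - (prim (f j).2).[x])).
    under [in RHS]eq_bigr do rewrite !mulrBr.
    rewrite !sumrB /u (horner_lincomb n a (derivn^~ p)) (horner_lincomb n a (fun j => (f j).1)).
    rewrite (horner_lincomb n a (fun j => prim (f j).2)).
    ring.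
  rewrite normrN normrM -/A'.
  apply: (@le_trans _ _ (A' * (n%:R * A * (C * lam ^+ s)))).
    rewrite ler_wpM2l//.
    apply: (sum_norm_le (u := fun j => p^`(j).[x] - (f j).1.[x] - (prim (f j).2).[x])).
      by move=> j jn; rewrite aA// ltnW.
    by move=> j jn; have [_ _] := fP j jn; apply.
  by rewrite !mulrA ler_wpM2r.
Qed.


Lemma size_derivn p n : (size p^`(n) <= size p - n)%N.
Proof.
apply/leq_sizeP => j nj; rewrite coef_derivn nth_default ?mul0rn//.
by rewrite -leq_subLR.
Qed.

Lemma pintM_le p q (e : R) : 0 <= e -> (forall x, 0 <= x <= 1 -> `|q.[x]| <= e) ->
  pint (p * q) <= 4^-1 * nrm2 p + e ^+ 2.
Proof.
move=> e0 qe; rewrite -[e ^+ 2]pintC -pintZ -pintD; apply: le_pint => x /qe.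
rewrite !(hornerM, hornerD, hornerZ, hornerC, horner_exp) => qx.
have : q.[x] ^+ 2 <= e ^+ 2 by rewrite -(real_normK (num_real q.[x])) lerXn2r ?nnegrE.
by have := sqr_ge0 (p.[x] / 2 - q.[x]); nra.
Qed.

(** The scalar part of [residual_bound]: [d] is the norm of the residual, [e] bounds its distance to
    a test polynomial. Half of d^2 is absorbed, a quarter from AM-GM and a quarter from the part of
    [e] proportional to [d], once [om] is small. *)
Lemma residual_algebra (A A1 C C0 ls om d del e : R) :
  0 <= A -> 0 <= A1 -> 0 <= C -> 0 <= del -> 0 <= d -> d <= A1 -> 0 <= om -> om <= 1 ->
  0 <= ls -> ls <= 1 ->
  e = A * (C * ls + 2 * om * (C0 * d)) -> 0 <= C0 ->
  32 * A ^+ 2 * C0 ^+ 2 * om ^+ 2 <= 1 ->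
  d ^+ 2 <= 4^-1 * d ^+ 2 + e ^+ 2 + del * (A1 + e) ->
  d ^+ 2 <= (4 * A ^+ 2 * C ^+ 2 + 2 * (A1 + A * (C + 2 * (C0 * A1)))) * (ls ^+ 2 + del).
Proof.
move=> A0 A10 C_0 del0 d0 dA om0 om1 ls0 ls1 eE C00 sm H.
have e1 : e <= A * (C + 2 * (C0 * A1)).
  rewrite eE ler_wpM2l// lerD//; first by rewrite ler_piMr.
  by rewrite -mulrA ler_wpM2l// -[leRHS]mul1r ler_pM ?mulr_ge0// ler_wpM2l.
have e2 : e ^+ 2 <= 2 * A ^+ 2 * C ^+ 2 * ls ^+ 2 + 4^-1 * d ^+ 2.
  have : e ^+ 2 <= 2 * (A * C * ls) ^+ 2 + 2 * (A * (2 * om * (C0 * d))) ^+ 2.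
    have := sqr_ge0 (A * C * ls - A * (2 * om * (C0 * d))).
    rewrite eE; set u := A * C * ls; set v := A * (2 * om * (C0 * d)) => uv.
    have -> : A * (C * ls + 2 * om * (C0 * d)) = u + v by rewrite /u /v; ring.
    by nra.
  have : 2 * (A * (2 * om * (C0 * d))) ^+ 2 <= 4^-1 * d ^+ 2.
    have := ler_wpM2r (sqr_ge0 d) sm.
    rewrite (_ : 2 * (A * (2 * om * (C0 * d))) ^+ 2 =
      4^-1 * (32 * A ^+ 2 * C0 ^+ 2 * om ^+ 2 * d ^+ 2)); last by field.
    lra.
  rewrite (_ : 2 * (A * C * ls) ^+ 2 = 2 * A ^+ 2 * C ^+ 2 * ls ^+ 2); last by ring.
  lra.
have d3 : del * (A1 + e) <= del * (A1 + A * (C + 2 * (C0 * A1))).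
  by rewrite ler_wpM2l// lerD2l.
move: H e2 d3; set E := A1 + A * (C + 2 * (C0 * A1)).
rewrite (_ : 2 * A ^+ 2 * C ^+ 2 * ls ^+ 2 = 2 * (A ^+ 2 * C ^+ 2 * ls ^+ 2)); last by ring.
rewrite (_ : (4 * A ^+ 2 * C ^+ 2 + _) * _ = 4 * (A ^+ 2 * C ^+ 2 * ls ^+ 2)
  + 4 * (A ^+ 2 * C ^+ 2 * del) + 2 * (E * ls ^+ 2) + 2 * (del * E)); last by ring.
have E0 : 0 <= E by rewrite /E addr_ge0// mulr_ge0// addr_ge0// !mulr_ge0.
have P0 : 0 <= A ^+ 2 * C ^+ 2 by rewrite mulr_ge0 ?sqr_ge0.
have := mulr_ge0 E0 (sqr_ge0 ls); have := mulr_ge0 P0 del0.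
lra.
Qed.

(** The squared norm of D is (D, D - q) + (D, q) for a test polynomial q close to D. [del] measures
    the defect of orthogonality, and [C * lam <= 1] allows the part of D - q proportional to the
    norm of D to be absorbed. *)
Lemma residual_bound n (a : nat -> R) (s c0 : nat) (H : R) : a n != 0 -> 0 <= H ->
  exists2 C : R, 0 <= C & forall N nu (lam : R) p h (del : R),
    0 < lam -> lam ^+ 2 * nu%:R = 1 -> (0 < c0)%N -> (nu + c0 + s + n <= N)%N ->
    (size p <= N.+1)%N -> (size h <= nu + c0)%N ->
    (forall i x, (i <= n)%N -> 0 <= x <= 1 -> `|p^`(i).[x]| <= 1) ->
    (forall x, 0 <= x <= 1 -> `|h.[x]| <= H) ->
    C * lam <= 1 -> 0 <= del ->
    (forall q M, (size q <= (N - n).+1)%N ->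
      (forall x, 0 <= x <= 1 -> `|q.[x]| <= M) ->
      `|pint ((diffop n a p - h) * q)| <= del * M) ->
    nrm2 (diffop n a p - h) <= C * (lam ^+ s ^+ 2 + del).
Proof.
move=> an0 H0; have [A aA] := coef_bound n a.
have A0 : 0 <= A := le_trans (normr_ge0 _) (aA n (leqnn n)).
have [C C_0 split] := residual_split s an0.
pose A1 := n.+1%:R * A * 1 + H.
pose A' := n%:R * A * 1.
(* Avoids the square root of C, since C <= (1 + C)^2. *)
pose C0 := 1 + C.
have C00 : 0 <= C0 by rewrite addr_ge0.
have A10 : 0 <= A1 by rewrite addr_ge0// !mulr_ge0.
have A'0 : 0 <= A' by rewrite !mulr_ge0.
pose C1 := 4 * A' ^+ 2 * C ^+ 2 + 2 * (A1 + A' * (C + 2 * (C0 * A1))).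
have C10 : 0 <= C1.
  by rewrite addr_ge0 ?mulr_ge0 ?sqr_ge0// ?addr_ge0// ?mulr_ge0// addr_ge0// !mulr_ge0.
have K0 : 0 <= 32 * A' ^+ 2 * C0 ^+ 2 by rewrite !mulr_ge0 ?sqr_ge0.
exists (C1 + 32 * A' ^+ 2 * C0 ^+ 2); first by rewrite addr_ge0.
move=> N nu lam p h del l0 ln c0p nN sp sh p1 hH sm del0 orth.
set D := diffop n a p - h in orth *.
have D0 : 0 <= nrm2 D := nrm2_ge0 D.
have lam1 : lam <= 1.
  have nu1 : 1 <= nu%:R :> R.
    by rewrite ler1n; case: (nu) ln => // /eqP; rewrite mulr0 eq_sym oner_eq0.
  rewrite -(@expr_le1 _ 2 lam) ?(ltW l0)//.
  by have := ler_wpM2l (sqr_ge0 lam) nu1; rewrite ln mulr1.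
(* Holder exponent 1/2 halves the Bernstein rate: [om] is nu^(-1/4) where [lam] is nu^(-1/2). *)
pose om := Num.sqrt lam; have om0 : 0 < om by rewrite sqrtr_gt0.
have om2 : om ^+ 2 = lam by rewrite sqr_sqrtr ?ltW.
have om4 : om ^+ 4 * nu%:R = 1 by rewrite (exprM om 2 2) om2.
pose d := Num.sqrt (nrm2 D); have d2 : d ^+ 2 = nrm2 D by rewrite sqr_sqrtr.
have d0 : 0 <= d by exact: sqrtr_ge0.
have nK : (nu < nu + c0)%N by rewrite -{1}[nu]addn0 ltn_add2l.
have /choice[f fP] : forall i, exists qt : {poly R} * {poly R}, (i < n)%N ->
    [/\ (size qt.1 <= nu + c0 + s)%N, nrm2 qt.2 <= C * nrm2 D &
      forall x, 0 <= x <= 1 ->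
        `|p^`(i).[x] - qt.1.[x] - (prim qt.2).[x]| <= C * lam ^+ s].
  move=> i; have [ni|ni] := ltnP i n; last by exists (0, 0).
  have [|q [t ?]] := split nu (nu + c0)%N lam p h l0 ln nK sh _ i ni.
    by move=> j x /ltnW; exact: p1.
  by exists (q, t).
pose b i := bern nu (fun k => (prim (f i).2).[k%:R / nu%:R]).
pose q := a n *: p^`(n) - h + \sum_(i < n) a i *: ((f i).1 + b i).
pose e := A' * (C * lam ^+ s + 2 * om * (C0 * d)).
have sq : (size q <= (N - n).+1)%N.
  rewrite (leq_trans (size_polyD _ _))// geq_max; apply/andP; split.
    rewrite (leq_trans (size_polyD _ _))// geq_max size_polyN; apply/andP; split.
      rewrite (leq_trans (size_scale_leq _ _))// (leq_trans (size_derivn _ _))//.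
      by clear -sp; lia.
    by apply: leq_trans sh _; clear -nN; lia.
  rewrite (leq_trans (size_sum _ _ _))//; apply/bigmax_leqP => j _.
  rewrite (leq_trans (size_scale_leq _ _))// (leq_trans (size_polyD _ _))// geq_max.
  have [sf _ _] := fP j (ltn_ord j); apply/andP; split.
    by apply: leq_trans sf _; clear -nN c0p; lia.
  by apply: leq_trans (size_bern _ _) _; clear -nN c0p; lia.
have De x : 0 <= x <= 1 -> `|(D - q).[x]| <= e.
  move=> x01.
  have -> : D - q = \sum_(i < n) a i *: (p^`(i) - (f i).1 - b i).
    rewrite /D /q diffopE; under [RHS]eq_bigr do rewrite -addrA -opprD scalerBr.
    by rewrite sumrB; ring.
  rewrite (horner_lincomb n a (fun i => p^`(i) - (f i).1 - b i)).
  rewrite /e /A' mulr1; apply: (sum_norm_le (u := fun i => (p^`(i) - (f i).1 - b i).[x])).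
    by move=> i ni; rewrite aA// ltnW.
  move=> i ni; have [_ tD qt] := fP i ni.
  have L0 : 0 <= C0 * d by rewrite mulr_ge0.
  have tL : nrm2 (f i).2 <= (C0 * d) ^+ 2.
    rewrite exprMn d2 (le_trans tD)// ler_wpM2r//.
    by rewrite /C0; clear -C_0; nra.
  have := bern_prim_holder om0 om4 L0 tL x01; rewrite -/(b i) distrC.
  have := qt x x01; rewrite !(hornerD, hornerN) => h1 h2.
  rewrite (_ : _ - _ - _ = (p^`(i).[x] - (f i).1.[x] - (prim (f i).2).[x]) +
    ((prim (f i).2).[x] - (b i).[x])); last by ring.
  by rewrite (le_trans (ler_normD _ _))// lerD.
have DA x : 0 <= x <= 1 -> `|D.[x]| <= A1.
  move=> x01; rewrite /D !(hornerD, hornerN) /A1 (le_trans (ler_normB _ _))//.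
  rewrite lerD ?hH//; rewrite /diffop (horner_lincomb n.+1 a (derivn^~ p)).
  by apply: (sum_norm_le (u := fun i => p^`(i).[x])) => i ni; rewrite ?aA ?p1.
have dA1 : d <= A1.
  rewrite -(ler_pXn2r (_ : 0 < 2)%N) ?nnegrE// d2 -[leRHS]pintC.
  apply: le_pint => x /DA DAx; rewrite hornerC horner_exp.
  by rewrite -(real_normK (num_real _)) lerXn2r ?nnegrE.
have ls0 : 0 <= lam ^+ s by rewrite exprn_ge0 ?ltW.
have e0 : 0 <= e.
  by rewrite mulr_ge0// addr_ge0// !mulr_ge0// ltW.
have qM x : 0 <= x <= 1 -> `|q.[x]| <= A1 + e.
  move=> x01; rewrite (_ : q = D - (D - q)); last by ring.
  by rewrite hornerD hornerN (le_trans (ler_normB _ _))// lerD ?DA ?De.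
have key : d ^+ 2 <= 4^-1 * d ^+ 2 + e ^+ 2 + del * (A1 + e).
  rewrite d2 {1}/nrm2 (_ : D ^+ 2 = D * (D - q) + D * q); last by ring.
  rewrite pintD lerD ?pintM_le//.
  by rewrite (le_trans (ler_norm _))// orth.
rewrite -d2; apply: (@le_trans _ _ (C1 * (lam ^+ s ^+ 2 + del))); last first.
  by rewrite ler_wpM2r// ?lerDl// addr_ge0 ?sqr_ge0.
apply: (residual_algebra (om := om) (e := e) A'0 A10) => //.
- exact: ltW.
- by rewrite -(@expr_le1 _ 2 om) ?(ltW om0)// om2.
- by apply: exprn_ile1 => //; exact: ltW.
- by rewrite om2; apply: le_trans sm; rewrite ler_wpM2r ?(ltW l0)// lerDr.
Qed.

End residual.

(** * Differentiation on [0,1] *)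

Section calculus.
Context {R : realType}.
Implicit Types (p q : {poly R}) (x y t c : R) (g : R -> R).

Lemma diffquot01P g x (l : R) : diffquot01 g x --> l <->
  forall e : R, 0 < e -> exists2 d : R, 0 < d & forall t, 0 <= t <= 1 -> t != x ->
    `|t - x| < d -> `|(g t - g x) / (t - x) - l| < e.
Proof.
split=> [/cvgrPdist_lt gl e e0|gl].
  have := gl e e0; rewrite !near_withinE => /nbhs_ballP[d /= d0 H]; exists d => // t t01 tx td.
  rewrite distrC; apply: H => //=; first by rewrite /ball/= distrC.
apply/cvgrPdist_lt => e /gl[d d0 H].
rewrite !near_withinE; apply/nbhs_ballP.
exists d => //= t; rewrite /ball/= distrC => td tx t01.
by rewrite distrC; apply: H => //; rewrite in_itv/= in t01.
Qed.

(** A relation rather than a value, so that derivability needs no side conditions; [derive01_lim]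
    recovers [derive01]. *)
Definition der01 g g' := forall x, 0 <= x <= 1 -> diffquot01 g x --> g' x.

(** Makes the limit in [derive01] unique. A nearby point exists on the side of the farther
    endpoint. *)
Lemma proper_within01 x : 0 <= x <= 1 -> ProperFilter (within `[0, 1] x^').
Proof.
move=> x01; apply: Build_ProperFilter; rewrite /within/= => /nbhs_ballP[d /= d0 H].
pose r := Num.min (d / 2) 2^-1.
have r0 : 0 < r by rewrite lt_min divr_gt0//= invr_gt0.
have rd : r < d by rewrite gt_min; apply/orP; left; lra.
have r2 : r <= 2^-1 by rewrite ge_min lexx orbT.
have [x2|x2] := leP x 2^-1.
  apply: (H (x + r)); rewrite /ball/= ?in_itv/=.
  - by rewrite opprD addNKr normrN gtr0_norm.
  - by rewrite -subr_eq0 addrC addKr gt_eqF.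
  - by clear -x01 x2 r0 r2; lra.
apply: (H (x - r)); rewrite /ball/= ?in_itv/=.
- by rewrite opprB addrCA subrr addr0 gtr0_norm.
- by rewrite -subr_eq0 addrAC subrr sub0r oppr_eq0 gt_eqF.
- by clear -x01 x2 r0 r2; lra.
Qed.

Lemma derive01_lim g x (l : R) : 0 <= x <= 1 -> diffquot01 g x --> l ->
  derive01 g x = l.
Proof.
move=> x01 gl; have PF := proper_within01 x01.
exact: (cvg_lim (@Rhausdorff R) gl).
Qed.

Lemma der01_ext g h g' h' : (forall x, 0 <= x <= 1 -> g x = h x) ->
  (forall x, 0 <= x <= 1 -> g' x = h' x) -> der01 g g' -> der01 h h'.
Proof.
move=> gh gh' gg' x x01; apply/diffquot01P => e /((diffquot01P _ _ _).1 (gg' x x01))[d d0 H].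
by exists d => // t t01 tx td; rewrite -!gh// -gh'// H.
Qed.

Lemma der01D g h g' h' : der01 g g' -> der01 h h' ->
  der01 (fun x => g x + h x) (fun x => g' x + h' x).
Proof.
move=> dg dh x x01; apply/diffquot01P => e e0.
have e2 : 0 < e / 2 by rewrite divr_gt0.
have [d1 d10 H1] := (diffquot01P _ _ _).1 (dg x x01) _ e2.
have [d2 d20 H2] := (diffquot01P _ _ _).1 (dh x x01) _ e2.
exists (Num.min d1 d2) => [|t t01 tx]; first by rewrite lt_min d10.
rewrite lt_min => /andP[/(H1 _ t01 tx) h1 /(H2 _ t01 tx) h2].
rewrite (_ : _ - _ = ((g t - g x) / (t - x) - g' x) + ((h t - h x) / (t - x) - h' x)); last by ring.
by rewrite (le_lt_trans (ler_normD _ _))//; lra.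
Qed.

Lemma der01Z g g' (c : R) : der01 g g' -> der01 (fun x => c * g x) (fun x => c * g' x).
Proof.
move=> dg x x01; apply/diffquot01P => e e0.
have c0 : 0 < `|c| + 1 by rewrite ltr_wpDl.
have [d d0 H] := (diffquot01P _ _ _).1 (dg x x01) _ (divr_gt0 e0 c0).
exists d => // t t01 tx td.
rewrite (_ : _ - _ = c * ((g t - g x) / (t - x) - g' x)); last by ring.
rewrite normrM; have := H t t01 tx td; set u := `|_ - _ : R|.
rewrite ltr_pdivlMr// => h; apply: le_lt_trans h.
by rewrite [leRHS]mulrC ler_wpM2r ?lerDl// normr_ge0.
Qed.

(** A quadratic remainder survives integration over a parameter and pointwise limits, so this
    criterion replaces interchange theorems for both. *)
Lemma der01_quadratic g g' (C : R) : (forall x y, 0 <= x <= 1 -> 0 <= y <= 1 ->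
  `|g y - g x - (y - x) * g' x| <= C * (y - x) ^+ 2) -> der01 g g'.
Proof.
move=> gC x x01; apply/diffquot01P => e e0.
have c0 : 0 < `|C| + 1 by rewrite ltr_wpDl.
exists (e / (`|C| + 1)) => [|t t01 tx]; first exact: divr_gt0.
have tx0 : t - x != 0 by rewrite subr_eq0.
rewrite ltr_pdivlMr// => td.
have -> : (g t - g x) / (t - x) - g' x = (g t - g x - (t - x) * g' x) / (t - x) by field.
rewrite normrM normfV ltr_pdivrMr ?normr_gt0//.
apply: le_lt_trans (gC x t x01 t01) _.
have -> : (t - x) ^+ 2 = `|t - x| * `|t - x| by rewrite -expr2 real_normK ?num_real.
rewrite mulrA ltr_pM2r ?normr_gt0//; apply: le_lt_trans td.
by rewrite [leRHS]mulrC ler_wpM2r// (le_trans (ler_norm _))// lerDl.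
Qed.

Lemma is_derive_der01 g (l : R) x : is_derive x 1 g l -> diffquot01 g x --> l.
Proof.
move=> [/[swap] <- /cvgrPdist_lt gl]; apply/diffquot01P => e e0.
have := gl e e0; rewrite near_withinE => /nbhs_ballP[d /= d0 H].
exists d => // t _ tx td; have := H (t - x); rewrite /ball/= sub0r normrN subr_eq0 => /(_ td tx).
by rewrite distrC [_ *: 1]mulr1 subrK [_ *: _]mulrC.
Qed.

Lemma der01_poly p : der01 (horner p) (horner p^`()).
Proof. by move=> x _; apply: is_derive_der01; exact: is_derive_poly. Qed.

Lemma der01_is_derive g (l : R) x : 0 < x < 1 -> diffquot01 g x --> l -> is_derive x 1 g l.
Proof.
move=> /andP[x0 x1] /diffquot01P gl.
have H : h^-1 *: ((g \o shift x) (h *: 1) - g x) @[h --> 0^'] --> l.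
  apply/cvgrPdist_lt => e /gl[d d0 H].
  rewrite near_withinE; apply/nbhs_ballP.
  exists (Num.min d (Num.min x (1 - x))) => /=; first by rewrite !lt_min d0 x0 subr_gt0.
  move=> h; rewrite /ball/= sub0r normrN !lt_min => /and3P[hd hx hx1] h0.
  rewrite [_ *: 1]mulr1 distrC; have := H (h + x); rewrite addrK [_ *: _]mulrC.
  apply=> //; last by rewrite -subr_eq0 addrK.
  by move: hx hx1; rewrite !ltr_norml => /andP[? ?] /andP[? ?]; apply/andP; split; lra.
by apply: DeriveDef; [exact: cvgP H | exact: cvg_lim H].
Qed.

Lemma der01_continuous g g' : der01 g g' -> {within `[0, 1], continuous g}.
Proof.
move=> dg; apply/subspace_continuousP => x; rewrite /= in_itv/= => x01.
apply/cvgrPdist_lt => e e0.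
have [d d0 H] := (diffquot01P _ _ _).1 (dg x x01) 1 ltr01.
have c0 : 0 < `|g' x| + 1 by rewrite ltr_wpDl.
rewrite near_withinE; apply/nbhs_ballP; exists (Num.min d (e / (`|g' x| + 1))) => /=.
  by rewrite lt_min d0 divr_gt0.
move=> t; rewrite /ball/= lt_min distrC ltr_pdivlMr// => /andP[td te]; rewrite in_itv/= => t01.
have [->|tx] := eqVneq t x; first by rewrite subrr normr0.
have tx0 : t - x != 0 by rewrite subr_eq0.
rewrite distrC; have := H t t01 tx td.
set u := (g t - g x) / (t - x) => hu.
rewrite (_ : g t - g x = u * (t - x)); last by rewrite /u divfK.
rewrite normrM mulrC; apply: le_lt_trans te; rewrite ler_wpM2l//.
by rewrite -[u](subrK (g' x)) addrC (le_trans (ler_normD _ _))// lerD2l ltW.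
Qed.

Lemma der01_mvt g g' x y : der01 g g' -> 0 <= x <= 1 -> 0 <= y <= 1 ->
  exists c, [/\ 0 <= c <= 1, `|c - x| <= `|y - x| & g y - g x = g' c * (y - x)].
Proof.
move=> dg; suff H u v : 0 <= u -> u <= v -> v <= 1 ->
    exists2 c, u <= c <= v & g v - g u = g' c * (v - u).
  move=> /andP[x0 x1] /andP[y0 y1]; have [xy|/ltW yx] := leP x y.
    have [c /andP[xc cy] e] := H _ _ x0 xy y1; exists c; split=> //; first lra.
    by rewrite !ger0_norm ?subr_ge0//; lra.
  have [c /andP[xc cy] e] := H _ _ y0 yx x1; exists c; split; first lra.
    by rewrite !ler0_norm ?subr_le0//; lra.
  by rewrite -opprB e -mulrN opprB.
move=> u0 uv v1; have [||c] := @MVT_segment R g g' u v uv.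
- move=> z; rewrite in_itv/= => /andP[uz zv]; apply: der01_is_derive; first lra.
  by apply: dg; lra.
- apply: continuous_subspaceW (der01_continuous dg).
  by move=> z /=; rewrite !in_itv/= => /andP[? ?]; lra.
by rewrite in_itv/= => ucv e; exists c.
Qed.

Lemma der01_lipschitz g g' (L : R) : der01 g g' ->
  (forall x, 0 <= x <= 1 -> `|g' x| <= L) ->
  forall x y, 0 <= x <= 1 -> 0 <= y <= 1 -> `|g y - g x| <= L * `|y - x|.
Proof.
move=> dg gL x y x01 y01; have [c [c01 _ ->]] := der01_mvt dg x01 y01.
by rewrite normrM ler_wpM2r// gL.
Qed.

Lemma der01_taylor g g1 g2 (L : R) : der01 g g1 -> der01 g1 g2 ->
  (forall x, 0 <= x <= 1 -> `|g2 x| <= L) ->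
  forall x y, 0 <= x <= 1 -> 0 <= y <= 1 ->
    `|g y - g x - (y - x) * g1 x| <= L * (y - x) ^+ 2.
Proof.
move=> d1 d2 gL x y x01 y01; have [c [c01 cx ->]] := der01_mvt d1 x01 y01.
have L0 : 0 <= L := le_trans (normr_ge0 _) (gL x x01).
rewrite mulrC -mulrBr normrM -real_normK ?num_real// expr2 mulrCA ler_wpM2l//.
by rewrite (le_trans (der01_lipschitz d2 gL x01 c01))// ler_wpM2l.
Qed.

(** Identifies explicitly given successive derivatives with the iterated [derive01n]; solutions are
    built in this way. *)
Lemma derive01n_chain (G : nat -> R -> R) (z : R -> R) M :
  (forall x, 0 <= x <= 1 -> z x = G 0 x) ->
  (forall i, (i < M)%N -> der01 (G i) (G i.+1)) ->
  (forall i x, (i <= M)%N -> 0 <= x <= 1 -> derive01n i z x = G i x) /\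
  (forall i x, (i < M)%N -> 0 <= x <= 1 -> derivable01 (derive01n i z) x).
Proof.
move=> z0 dG.
have H i x : (i <= M)%N -> 0 <= x <= 1 -> derive01n i z x = G i x.
  elim: i x => [|i IH] x iM x01; first exact: z0.
  rewrite /derive01n iterS -/(derive01n i z); apply: derive01_lim => //.
  by apply: (der01_ext _ _ (dG i iM)) => // t t01; rewrite IH// ltnW.
split=> // i x iM x01; apply: (cvgP (G i.+1 x)).
by apply: (der01_ext _ _ (dG i iM)) => // t t01; rewrite H// ltnW.
Qed.

Lemma Cn01_der01 r g i : Cn01 r g -> (i < r)%N ->
  der01 (derive01n i g) (derive01n i.+1 g).
Proof. by move=> [dg _] ir x x01; exact: dg. Qed.

Lemma derive01n_poly p i x : 0 <= x <= 1 -> derive01n i (horner p) x = p^`(i).[x].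
Proof.
have [H _] := @derive01n_chain (fun i => horner p^`(i)) (horner p) i
  (fun _ _ => erefl) (fun j _ => @der01_poly p^`(j)).
exact: H.
Qed.

End calculus.

(** * Superconvergence *)

Section superconvergence.
Context {R : realType}.
Implicit Types (p q h D : {poly R}) (x y c : R) (g : nat -> R -> R).

(** If [q] is close to the derivative of [g], then [g] minus a primitive of [q] has a small
    Lipschitz constant, and its Bernstein polynomial gains a factor [2 * lam]. *)
Lemma jackson_step nu (lam : R) (g g1 : R -> R) q (eta : R) :
  0 < lam -> lam ^+ 2 * nu%:R = 1 -> der01 g g1 -> 0 <= eta ->
  (forall x, 0 <= x <= 1 -> `|g1 x - q.[x]| <= eta) ->
  exists2 b : {poly R}, (size b <= maxn (size q).+1 nu.+1)%N &
    forall x, 0 <= x <= 1 -> `|g x - b.[x]| <= 2 * lam * eta.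
Proof.
move=> l0 ln dg e0 gq; pose f x := g x + -1 * (prim q).[x].
have df : der01 f (fun x => g1 x + -1 * q.[x]).
  by apply: der01D => //; apply: der01Z; have := @der01_poly _ (prim q); rewrite deriv_prim.
exists (prim q + bern nu (fun k => f (k%:R / nu%:R))).
  rewrite (leq_trans (size_polyD _ _))// geq_max !leq_max size_prim.
  by rewrite size_bern orbT.
move=> x x01; have := bern_lipschitz (f := f) l0 ln x01 e0.
rewrite distrC (_ : f x - _ = g x - (prim q + bern nu (fun k => f (k%:R / nu%:R))).[x]); last first.
  by rewrite hornerD /f; ring.
apply=> t t01; apply: (der01_lipschitz df) => // y y01.
by rewrite mulN1r gq.
Qed.

Lemma jackson nu (lam : R) S g (B : R) :
  0 < lam -> lam ^+ 2 * nu%:R = 1 -> 0 <= B ->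
  (forall i, (i < S)%N -> der01 (g i) (g i.+1)) ->
  (forall x, 0 <= x <= 1 -> `|g S x| <= B) ->
  exists2 q : {poly R}, (size q <= nu + 1 + S)%N &
    forall x, 0 <= x <= 1 -> `|g 0%N x - q.[x]| <= (2 * lam) ^+ S * B.
Proof.
move=> l0 ln B0; elim: S g => [|S IH] g dg gB.
  exists 0; first by rewrite size_poly0.
  by move=> x x01; rewrite horner0 subr0 mul1r gB.
have [q sq gq] := IH (fun i => g i.+1) (fun i iS => dg i.+1 iS) gB.
have [|b sb gb] := jackson_step l0 ln (dg 0%N (ltn0Sn S)) _ gq.
  by rewrite mulr_ge0// exprn_ge0// mulr_ge0// ltW.
exists b; first by apply: leq_trans sb _; rewrite geq_max; clear -sq; lia.
by move=> x /gb; rewrite exprS -[X in _ -> _ <= X]mulrA.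
Qed.

(** The derivative of order Q is approximated by [jackson] and integrated back with the right values
    at 0; on an interval of length 1 the error does not grow. *)
Lemma jackson_simultaneous nu (lam : R) S Q g (B : R) :
  0 < lam -> lam ^+ 2 * nu%:R = 1 -> 0 <= B ->
  (forall i, (i < Q + S)%N -> der01 (g i) (g i.+1)) ->
  (forall x, 0 <= x <= 1 -> `|g (Q + S)%N x| <= B) ->
  exists2 h : {poly R}, (size h <= nu + (1 + S + Q))%N &
    forall i x, (i <= Q)%N -> 0 <= x <= 1 -> `|g i x - h^`(i).[x]| <= (2 * lam) ^+ S * B.
Proof.
move=> l0 ln B0; elim: Q g => [|Q IH] g dg gB.
  have [q sq gq] := jackson l0 ln B0 dg gB; exists q; first by clear -sq; lia.
  by move=> [|//] x _ /gq.
have [h sh gh] := IH (fun i => g i.+1) (fun i iS => dg i.+1 iS) gB.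
have e0 : 0 <= (2 * lam) ^+ S * B by rewrite mulr_ge0// exprn_ge0// mulr_ge0// ltW.
exists ((g 0%N 0)%:P + prim h).
  rewrite (leq_trans (size_polyD _ _))// geq_max; apply/andP; split.
    by rewrite (leq_trans (size_polyC_leq1 _))//; clear; lia.
  by apply: leq_trans (size_prim _) _; clear -sh; lia.
move=> [|i] x iQ x01.
  have df : der01 (fun x => g 0%N x + -1 * (prim h).[x]) (fun x => g 1%N x + -1 * h.[x]).
    apply: der01D; first exact: dg.
    by apply: der01Z; have := @der01_poly _ (prim h); rewrite deriv_prim.
  have z01 : 0 <= (0 : R) <= 1 by rewrite lexx ler01.
  have := der01_lipschitz df _ z01 x01 => /(_ ((2 * lam) ^+ S * B)).
  rewrite prim0 mulr0 addr0 derivn0 hornerD hornerC.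
  rewrite (_ : _ - g 0%N 0 = g 0%N x - (g 0%N 0 + (prim h).[x])); last by ring.
  move=> H; apply: le_trans (H _) _.
    by move=> t t01; rewrite mulN1r; exact: (gh 0%N).
  by rewrite ler_piMr// subr0 ger0_norm; move: x01 => /andP[].
by rewrite derivSn derivD derivC add0r deriv_prim; exact: gh.
Qed.

(** One of the [i.+1] factors pays for the passage from the L^2 norm to the supremum norm. *)
Lemma markov_iter N p (l : R) i : (size p <= N.+1)%N -> 0 < l -> nrm2 p <= l ^+ 2 ->
  forall x, 0 <= x <= 1 -> `|p^`(i).[x]| <= (4 * N.+2%:R ^+ 3) ^+ i.+1 * l.
Proof.
move=> sp l0 pl; elim: i => [|i IH] x x01.
  by rewrite expr1 derivn0; apply: (nrm2_markov sp).
rewrite derivnS.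
have sd : (size p^`(i) <= N.+1)%N.
  by rewrite (leq_trans (size_derivn _ _))// (leq_trans _ sp)// leq_subr.
apply: le_trans (poly_markov sd IH x01) _.
rewrite [X in _ <= X * _]exprS -[leRHS]mulrA ler_wpM2r//.
  by rewrite mulr_ge0 ?exprn_ge0 ?mulr_ge0 ?exprn_ge0// ltW.
by rewrite ler_wpM2l// lerXn2r ?nnegrE// ler_nat.
Qed.

(** Half of the degree goes to the Bernstein polynomials: the fixed increments of degree then fit
    below N - n, while N./2 is still comparable to N. *)
Lemma lam_small (e : R) : 0 < e -> exists N0, forall N, (N0 <= N)%N ->
  exists2 lam : R, 0 < lam <= e & lam ^+ 2 * (N./2)%:R = 1.
Proof.
move=> e0; exists (2 * (Num.bound (e ^- 2)).+1)%N => N hN.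
set nu := N./2.
have hnu : (Num.bound (e ^- 2) < nu)%N by rewrite /nu; clear -hN; lia.
have e2 : e ^- 2 < nu%:R :> R.
  by apply: lt_trans (archi_boundP _) _; rewrite ?invr_ge0 ?sqr_ge0// ltr_nat.
have nu0 : (0 : R) < nu%:R by rewrite ltr0n (leq_trans _ hnu).
exists (Num.sqrt nu%:R)^-1; last by rewrite exprVn sqr_sqrtr ?ltW// mulVf// gt_eqF.
rewrite invr_gt0 sqrtr_gt0 nu0/= -[e]invrK lef_pV2 ?posrE ?sqrtr_gt0 ?invr_gt0//.
rewrite -(@ler_pXn2r _ 2) ?nnegrE ?sqrtr_ge0 ?invr_ge0 ?(ltW e0)//.
by rewrite sqr_sqrtr ?(ltW nu0)// exprVn ltW.
Qed.

(* The residual is so small in L^2 that the polynomial losses of Markov's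
   inequality are affordable: the equation holds in the limit together with
   its first Q derivatives. *)
Lemma superconvergence Q : exists S, forall n (a : nat -> R) (B e : R),
  a n != 0 -> 0 <= B -> 0 < e -> exists N0, forall N p g, (N0 <= N)%N ->
  (size p <= N.+1)%N ->
  (forall i x, (i <= n)%N -> 0 <= x <= 1 -> `|p^`(i).[x]| <= 1) ->
  (forall i, (i < Q + S)%N -> der01 (g i) (g i.+1)) ->
  (forall i x, (i <= Q + S)%N -> 0 <= x <= 1 -> `|g i x| <= B) ->
  (forall q, (size q <= (N - n).+1)%N ->
     pint ((diffop n a p - cheb_interp N (g 0%N)) * q) = 0) ->
  forall i x, (i <= Q)%N -> 0 <= x <= 1 ->
    `|(diffop n a p)^`(i).[x] - g i x| <= e.
Proof.
(* Each Markov factor costs lam^(-6) and there are at most Q + 1 of them, so lam^s leaves one factor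
   lam to spare. Interpolation costs lam^(-2), and its error must be of the order lam^(2s) of the
   squared norm, whence S. *)
pose s := (6 * Q.+1 + 1)%N; pose S := (2 * s + 2)%N.
exists S => n a B e an0 B0 e0.
pose c0 := (1 + S + Q)%N.
pose H := B + 2 ^+ S * B.
have S0 : (0 : R) <= 2 ^+ S by rewrite exprn_ge0.
have H0 : 0 <= H by rewrite addr_ge0// mulr_ge0.
have [C C0 key] := residual_bound s c0 an0 H0.
pose d0 := 8 * 2 ^+ S * B; have d00 : 0 <= d0 by rewrite !mulr_ge0.
pose c := 1 + C * (1 + d0).
have c1 : 1 <= c by rewrite lerDl mulr_ge0// addr_ge0.
pose E := 256 ^+ Q.+1 * c + 2 ^+ S * B.
have E0 : 0 <= E by rewrite addr_ge0// mulr_ge0// ?exprn_ge0// (le_trans ler01).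
(* Three demands on lam: the final error [E * lam] is at most [e], the smallness condition of
   [residual_bound] holds, and lam <= 1. *)
pose e' := Num.min (e / (E + 1)) (Num.min (C + 1)^-1 1).
have E1 : 0 < E + 1 by rewrite ltr_wpDl.
have C1 : 0 < C + 1 by rewrite ltr_wpDl.
have e'0 : 0 < e' by rewrite !lt_min divr_gt0//= invr_gt0 C1/=.
have [N0 N0P] := lam_small e'0.
exists (N0 + 2 * (c0 + s + n + 1))%N => N p g NN sp p1 dg gB orth i x iQ x01.
have [|lam /andP[l0 le'] ln] := N0P N; first by rewrite (leq_trans _ NN)// leq_addr.
set nu := N./2 in ln.
have nuN : (nu + c0 + s + n <= N)%N by rewrite /nu; clear -NN; lia.
have Nnu : (N.+2 <= 4 * nu)%N by rewrite /nu; clear -NN; lia.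
have {N0 N0P NN} _ : True by [].
move: le'; rewrite !le_min => /and3P[lE lC l1].
have nuE : nu%:R = lam ^- 2 :> R.
  by apply: (mulfI (_ : lam ^+ 2 != 0)); rewrite ?ln ?mulfV// expf_neq0// gt_eqF.
have [h sh gh] := jackson_simultaneous (S := S) (Q := Q) l0 ln B0 dg (gB _ ^~ (leqnn _)).
have eta0 : 0 <= (2 * lam) ^+ S * B by rewrite mulr_ge0// exprn_ge0// mulr_ge0// ltW.
have etaS : (2 * lam) ^+ S * B <= 2 ^+ S * B.
  by rewrite ler_wpM2r// exprMn ler_piMr// exprn_ile1// ltW.
have hH y : 0 <= y <= 1 -> `|h.[y]| <= H.
  move=> y01; rewrite -[h.[y]](subrK (g 0%N y)) addrC (le_trans (ler_normD _ _))//.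
  by rewrite lerD ?gB// distrC (le_trans (gh 0%N y _ y01)).
pose del := d0 * lam ^+ s ^+ 2.
have lam_s : 0 < lam ^+ s by rewrite exprn_gt0.
have del0 : 0 <= del by rewrite mulr_ge0// sqr_ge0.
(* The difference has degree at most N, and its node values are those of [g 0%N] minus [h], which
   Jackson's estimate controls. *)
have Ih y : 0 <= y <= 1 -> `|(cheb_interp N (g 0%N) - h).[y]| <= del.
  move=> y01; apply: le_trans (cheb_lebesgue (N := N) (B := (2 * lam) ^+ S * B) _ _ y01) _.
  - rewrite (leq_trans (size_polyD _ _))// geq_max size_polyN size_cheb_interp/=.
    by apply: leq_trans sh _; clear -nuN; rewrite /c0 in nuN; lia.
  - by move=> j jN; rewrite hornerD hornerN cheb_interpE//; apply: (gh 0%N) => //; exact: cheb_node01.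
  have N1 : (N.+1%:R : R) <= 4 * lam ^- 2.
    by rewrite -nuE -natrM ler_nat (leq_trans _ Nnu).
  have -> : del = 2 * (4 * lam ^- 2) * ((2 * lam) ^+ S * B).
    rewrite /del /d0 exprMn /S exprD mulnC exprM [lam ^+ (s * 2 + 2)]exprD [lam ^+ (s * 2)]exprM.
    by field; rewrite gt_eqF.
  by rewrite ler_wpM2r// ler_wpM2l.
have {}key : nrm2 (diffop n a p - h) <= C * (lam ^+ s ^+ 2 + del).
  apply: (key N nu lam p h del) => //.
    rewrite (le_trans _ (_ : (C + 1) * lam <= 1))//; first by rewrite ler_wpM2r ?lerDl// ltW.
    by rewrite mulrC -ler_pdivlMr// div1r.
  move=> q M sq qM.
  have M0 : 0 <= M := le_trans (normr_ge0 _) (qM x x01).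
  have -> : (diffop n a p - h) * q =
      (diffop n a p - cheb_interp N (g 0%N)) * q + (cheb_interp N (g 0%N) - h) * q by ring.
  rewrite pintD orth// add0r ler_norml -[- (_ * _)]pintC -[X in _ && (_ <= X)]pintC.
  have qD y : 0 <= y <= 1 ->
      `|(cheb_interp N (g 0%N) - h).[y] * q.[y]| <= del * M.
    by move=> y01; rewrite normrM ler_pM ?Ih ?qM.
  by apply/andP; split; apply: le_pint => y /qD; rewrite hornerC hornerM ler_norml => /andP[].
pose l := c * lam ^+ s.
have l_0 : 0 < l by rewrite mulr_gt0// (lt_le_trans ltr01).
have {}key : nrm2 (diffop n a p - h) <= l ^+ 2.
  apply: le_trans key _; rewrite /del /l exprMn.
  rewrite -[X in X + _]mul1r -mulrDl mulrA ler_wpM2r ?sqr_ge0//.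
  apply: (@le_trans _ _ c); first by rewrite lerDr.
  by rewrite expr2 ler_peMr// (le_trans _ c1).
have sD : (size (diffop n a p - h)%R <= N.+1)%N.
  rewrite (leq_trans (size_polyD _ _))// geq_max size_polyN; apply/andP; split.
    rewrite (leq_trans (size_sum _ _ _))//; apply/bigmax_leqP => j _.
    rewrite (leq_trans (size_scale_leq _ _))// (leq_trans (size_derivn _ _))//.
    by rewrite (leq_trans _ sp)// leq_subr.
  by apply: leq_trans sh _; clear -nuN; rewrite /c0 in nuN; lia.
have M1 := @markov_iter N _ l i sD l_0 key x x01.
have M2 : (4 * N.+2%:R ^+ 3) ^+ i.+1 * l <= 256 ^+ Q.+1 * c * lam.
  have N2 : 4 * (N.+2%:R : R) ^+ 3 <= 256 * lam ^- 6.
    have : (N.+2%:R : R) <= 4 * lam ^- 2 by rewrite -nuE -natrM ler_nat.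
    move=> hN; have -> : 256 * lam ^- 6 = 4 * (4 * lam ^- 2) ^+ 3.
      by field; rewrite gt_eqF.
    by rewrite ler_wpM2l// lerXn2r ?nnegrE// mulr_ge0// invr_ge0 sqr_ge0.
  apply: (@le_trans _ _ ((256 * lam ^- 6) ^+ i.+1 * l)).
    rewrite ler_wpM2r ?(ltW l_0)// lerXn2r ?nnegrE ?mulr_ge0 ?exprn_ge0//.
    by rewrite invr_ge0 exprn_ge0// ltW.
  have -> : (256 * lam ^- 6) ^+ i.+1 * l = 256 ^+ i.+1 * c * (lam ^+ (6 * (Q - i)) * lam).
    rewrite exprMn /l exprVn -exprM.
    have -> : lam ^+ s = lam ^+ (6 * i.+1) * (lam ^+ (6 * (Q - i)) * lam).
      by rewrite -exprSr -exprD; congr (_ ^+ _); rewrite /s; clear -iQ; lia.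
    by field; rewrite expf_neq0// gt_eqF.
  rewrite ler_pM ?mulr_ge0 ?exprn_ge0 ?(le_trans ler01 c1) ?(ltW l0)//.
    by rewrite ler_wpM2r ?(le_trans ler01 c1)// ler_weXn2l// ler1n.
  by rewrite ler_piMl ?(ltW l0)// exprn_ile1// ltW.
have M3 : (2 * lam) ^+ S * B <= 2 ^+ S * B * lam.
  rewrite exprMn mulrAC ler_wpM2l ?mulr_ge0//.
  by rewrite /S addn2 exprS ler_piMr ?(ltW l0)// exprn_ile1// ltW.
have -> : (diffop n a p)^`(i).[x] - g i x =
    (diffop n a p - h)^`(i).[x] + (h^`(i).[x] - g i x).
  by rewrite derivnB hornerD hornerN; ring.
apply: (@le_trans _ _ (E * lam)).
  rewrite (le_trans (ler_normD _ _))// /E mulrDl lerD ?(le_trans M1)//.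
  by rewrite distrC (le_trans (gh i x iQ x01)).
rewrite -(@ler_pM2l _ (E + 1)) //.
apply: (@le_trans _ _ (E * e)); last by rewrite ler_wpM2r ?lerDl// ltW.
rewrite mulrCA ler_wpM2l//; move: lE; rewrite ler_pdivlMr//.
by rewrite mulrC.
Qed.

End superconvergence.

(** * Integrals on [0,1] *)

Section integrals.
Context {R : realType}.
Implicit Types (p q : {poly R}) (x t c M : R) (u v w : R -> R).
Local Notation mu := (@lebesgue_measure R).

Lemma Rintegral_pint p : \int[mu]_(x in `[0, 1]) p.[x] = pint p.
Proof.
rewrite /Rintegral (@continuous_FTC2 _ _ (horner (prim p))) ?ltr01//.
- by rewrite prim0 -EFinB subr0.
- by apply: continuous_subspaceT; exact: continuous_horner.
- split=> [x _||]; first exact: derivable_horner.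
  + by apply: cvg_at_right_filter; exact: continuous_horner.
  + by apply: cvg_at_left_filter; exact: continuous_horner.
- by move=> x _; rewrite -derivE deriv_prim.
Qed.

Lemma inner01_poly p q : inner01 (horner p) (horner q) = pint (p * q).
Proof.
by rewrite /inner01 -Rintegral_pint; apply: eq_Rintegral => x _; rewrite hornerM.
Qed.

(** This class consists of integrable functions and is closed under sums, products and the
    fractional integral, so it settles integrability throughout. *)
Definition bddmeas01 v := measurable_fun (`[0, 1] : set R) v /\ exists M, forall x, 0 <= x <= 1 -> `|v x| <= M.

Lemma itv01 x : `[0, 1]%classic x <-> 0 <= x <= 1.
Proof. by rewrite /= in_itv. Qed.

Lemma mu01 : mu `[0, 1] = 1%E.
Proof. by rewrite lebesgue_measure_itv/= lte_fin ltr01 oppr0 adde0. Qed.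

Lemma continuous_bddmeas01 v : {within `[0, 1], continuous v} -> bddmeas01 v.
Proof.
move=> cv; split; first exact: subspace_continuous_measurable_fun.
have /compact_bounded[M [_ H]] := continuous_compact cv (@segment_compact R 0 1).
exists (M + 1) => x x01; apply: (H (M + 1)); first by rewrite ltrDl.
by exists x => //; apply/itv01.
Qed.

Lemma bddmeas01_integrable v : bddmeas01 v -> mu.-integrable `[0, 1] (EFin \o v).
Proof.
move=> [mv [M vM]]; apply: measurable_bounded_integrable => //.
  by rewrite [X in (X < _)%E]mu01 ltry.
exists M; split; rewrite ?num_real// => x Mx y /itv01 y01.
by apply: (le_trans (vM y y01)); exact: ltW.
Qed.

Lemma bddmeas01_cst c : bddmeas01 (fun=> c).
Proof. by split; [exact: measurable_cst | exists `|c|]. Qed.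

Lemma bddmeas01D u v : bddmeas01 u -> bddmeas01 v -> bddmeas01 (fun x => u x + v x).
Proof.
move=> [mu_ [M uM]] [mv [K vK]]; split; first exact: measurable_funD.
by exists (M + K) => x x01; rewrite (le_trans (ler_normD _ _))// lerD ?uM ?vK.
Qed.

Lemma bddmeas01M u v : bddmeas01 u -> bddmeas01 v -> bddmeas01 (fun x => u x * v x).
Proof.
move=> [mu_ [M uM]] [mv [K vK]]; split; first exact: measurable_funM.
by exists (M * K) => x x01; rewrite normrM ler_pM ?uM ?vK.
Qed.

Lemma bddmeas01_ext u v : (forall x, 0 <= x <= 1 -> u x = v x) -> bddmeas01 u -> bddmeas01 v.
Proof.
move=> uv [mu_ [M uM]]; split.
  by apply: eq_measurable_fun mu_ => x; rewrite inE => /itv01 /uv.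
by exists M => x x01; rewrite -uv// uM.
Qed.

Lemma Rintegral01_le v M : bddmeas01 v -> (forall x, 0 <= x <= 1 -> `|v x| <= M) ->
  `|\int[mu]_(x in `[0, 1]) v x| <= M.
Proof.
move=> bv vM; have iv := bddmeas01_integrable bv.
apply: (le_trans (le_normr_Rintegral _ iv)) => //.
have -> : M = \int[mu]_(x in `[0, 1]) (cst M x).
  by rewrite Rintegral_cst// [X in fine X]mu01 /= mulr1.
apply: le_Rintegral => //; first exact: integrable_norm.
  exact: bddmeas01_integrable (bddmeas01_cst M).
Qed.

Lemma is_derive_reflected_powR (e : R) x t : t < x ->
  is_derive t 1 (fun t => (x - t) `^ e) (- (e * (x - t) `^ (e - 1))).
Proof.
move=> tx; have xt : 0 < x - t by rewrite subr_gt0.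
have d1 : is_derive t 1 (fun t : R => x - t) (-1).
  by apply: is_derive_eq; rewrite add0r mul1r.
have d2 := @is_derive1_powR R e _ xt.
have := @is_derive1_comp R (@powR R ^~ e) (fun t : R => x - t) t _ _ d2 d1.
by rewrite mulrN1.
Qed.

(** * The weakly singular kernel of the fractional integral *)

Section power_kernel.
Variable g : R.
Hypothesis g01 : 0 < g < 1.
Let g0 : 0 < g. Proof. by case/andP: g01. Qed.

Let ker x t := (x - t) `^ (g - 1).

Let ker_ge0 x t : 0 <= ker x t. Proof. exact: powR_ge0. Qed.

Let ker_prim x t : t < x ->
  is_derive t 1 (fun t => - g^-1 * (x - t) `^ g) (ker x t).
Proof.
move=> tx; have d := is_derive_reflected_powR g tx.
have -> : (fun t => - g^-1 * (x - t) `^ g) = - g^-1 \*: (fun t => (x - t) `^ g).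
  by apply/funext.
by apply: is_derive_eq; rewrite /ker /GRing.scale/=; field; exact: lt0r_neq0.
Qed.

Let measurable_ker x : measurable_fun setT (ker x).
Proof.
apply: (@measurableT_comp _ _ _ _ _ _ (@powR R ^~ (g - 1))); first exact: measurable_powR.
exact: measurable_funB.
Qed.

Let measurable_ker_on (A : set R) x : measurable A -> measurable_fun A (ker x).
Proof. by move=> mA; exact: measurable_funTS. Qed.

Let measurable_EFin_ker (A : set R) x : measurable A -> measurable_fun A (EFin \o ker x).
Proof. by move=> mA; apply/measurable_EFinP; exact: measurable_funTS. Qed.

(** Stopping at [b < x] keeps the antiderivative differentiable up to the endpoint; its increment is
    at most x^g / g <= 1 / g. *)
Lemma power_kernel_le_sub x (b : R) : x <= 1 -> 0 < b -> b < x ->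
  (\int[mu]_(t in `[0%R, b]) (ker x t)%:E <= (g^-1)%:E)%E.
Proof.
move=> x1 b0 bx.
have cont t : t < x -> {for t, continuous (fun t => - g^-1 * (x - t) `^ g)}.
  by move=> /ker_prim[d _]; exact/differentiable_continuous/derivable1_diffP.
rewrite (@continuous_FTC2 _ _ (fun t => - g^-1 * (x - t) `^ g))//.
- rewrite -EFinB lee_fin subr0.
  have : x `^ g <= 1 `^ g.
    by apply: ge0_ler_powR => //; rewrite ?nnegrE// ltW// (lt_trans b0).
  rewrite powR1.
  have h1 := powR_ge0 (x - b) g; have i0 : 0 < g^-1 by rewrite invr_gt0.
  by move=> h2; nra.
- apply: derivable_within_continuous => t; rewrite in_itv/= => /andP[_ tb].
  by have [] := is_derive_reflected_powR (g - 1) (le_lt_trans tb bx).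
- split.
  + move=> t; rewrite in_itv/= => /andP[_ tb].
    by have [] := ker_prim (lt_trans tb bx).
  + by apply: cvg_at_right_filter; apply: cont; exact: lt_trans bx.
  + by apply: cvg_at_left_filter; exact: cont.
- move=> t; rewrite in_itv/= => /andP[_ tb].
  by have [_ <-] := ker_prim (lt_trans tb bx); rewrite derive1E.
Qed.

Lemma power_kernel_le x : 0 < x -> x <= 1 ->
  (\int[mu]_(t in `[0%R, x]) (ker x t)%:E <= (g^-1)%:E)%E.
Proof.
move=> x0 x1.
rewrite -integral_itv_bndo_bndc; last exact: measurable_EFin_ker.
(* An exhaustion for monotone convergence; [i.+2] makes the right endpoint positive already for i =
   0. *)
pose F (i : nat) : set R := `[0, x - x / i.+2%:R]%classic.
have UF : `[0, x[%classic = \bigcup_i F i.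
  apply/seteqP; split=> t /=; rewrite in_itv/=.
    move=> /andP[t0 tx]; have d0 : 0 < x - t by rewrite subr_gt0.
    exists (Num.bound (x / (x - t))) => //; rewrite /F/= in_itv/= t0/=.
    rewrite lerBrDl -lerBrDr ler_pdivrMr ?ltr0n// mulrC -ler_pdivrMr//.
    apply: ltW; apply: lt_trans (archi_boundP _) _; last by rewrite ltr_nat.
    by rewrite divr_ge0 ?ltW.
  move=> [i _]; rewrite /F/= in_itv/= => /andP[-> ti]/=.
  by rewrite (le_lt_trans ti)// ltrBlDr ltrDl divr_gt0.
rewrite UF; have := @ge0_nondecreasing_set_cvg_integral _ (measurableTypeR R) R F (EFin \o ker x) mu.
move=> /(_ _ _ _ _)/wrap[||||].
- move=> i j ij; apply/subsetPset => t; rewrite /F /= !in_itv/= => /andP[-> ti]/=.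
  rewrite (le_trans ti)// lerD2l lerN2 ler_pM2l// lef_pV2 ?posrE// ler_nat.
  by rewrite !ltnS.
- by move=> i; exact: measurable_itv.
- by move=> i; apply: measurable_EFin_ker; exact: measurable_itv.
- by move=> i t _; rewrite /= lee_fin.
move=> cF; rewrite -(cvg_lim _ cF)//; apply: lime_le; first exact: cvgP cF.
apply: nearW => i; apply: power_kernel_le_sub => //.
  by rewrite subr_gt0 ltr_pdivrMr// ltr_pMr// ltr1n.
by rewrite ltrBlDr ltrDl divr_gt0.
Qed.

Lemma power_kernel_integrable x : 0 <= x <= 1 ->
  mu.-integrable `[0, x] (EFin \o ker x).
Proof.
move=> /andP[x0 x1]; apply/integrableP; split; first exact: measurable_EFin_ker.
under eq_integral do rewrite /= ger0_norm//.
move: x0; rewrite le_eqVlt => /predU1P[<-|x0]; last first.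
  by rewrite (le_lt_trans (power_kernel_le x0 x1))// ltry.
by rewrite set_itv1 integral_set1.
Qed.

Lemma Rintegral_power_kernel_le x : 0 <= x <= 1 ->
  \int[mu]_(t in `[0, x]) ker x t <= g^-1.
Proof.
move=> /[dup] x01 /andP[x0 x1]; rewrite -lee_fin fineK; last first.
  exact: integrable_fin_num (power_kernel_integrable x01).
move: x0; rewrite le_eqVlt => /predU1P[<-|x0]; last exact: power_kernel_le.
by rewrite set_itv1 integral_set1 lee_fin invr_ge0 ltW.
Qed.

(* The fractional integral without its factor 1 / Gamma(g). *)
Definition frac_int v x := \int[mu]_(t in `[0, x]) (ker x t * v t).

Let sub01 x : 0 <= x <= 1 -> `[0, x]%classic `<=` (`[0, 1]%classic : set R).
Proof.
by move=> /andP[_ x1] t; rewrite /= !in_itv/= => /andP[-> tx]; rewrite (le_trans tx).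
Qed.

Let frac_integrable v x : bddmeas01 v -> 0 <= x <= 1 ->
  mu.-integrable `[0, x] (EFin \o (fun t => ker x t * v t)).
Proof.
move=> [mv [M vM]] x01.
have mvx : measurable_fun (`[0, x] : set R) v.
  by apply: measurable_funS mv => //; exact: sub01.
apply: (@le_integrable _ (measurableTypeR R) R mu _ _ _ (EFin \o (fun t => M * ker x t))) => //.
- by apply/measurable_EFinP; apply: measurable_funM => //; exact: measurable_ker_on.
- move=> t tx /=; rewrite lee_fin normrM mulrC [leRHS]ger0_norm.
    rewrite [X in _ * X]ger0_norm// ler_wpM2r// vM//; exact/itv01/(sub01 x01).
  rewrite mulr_ge0//; apply: le_trans (vM 0 _); rewrite ?lexx ?ler01//.
- exact: integrableZl (power_kernel_integrable x01).
Qed.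

Lemma frac_int_le v x M : bddmeas01 v -> 0 <= x <= 1 ->
  (forall x, 0 <= x <= 1 -> `|v x| <= M) -> `|frac_int v x| <= g^-1 * M.
Proof.
move=> bv x01 vM; have M0 : 0 <= M := le_trans (normr_ge0 _) (vM x x01).
have iv := frac_integrable bv x01.
apply: le_trans (le_normr_Rintegral _ iv) _ => //.
apply: (@le_trans _ _ (\int[mu]_(t in `[0, x]) (M * ker x t))).
  apply: le_Rintegral => //; first exact: integrable_norm.
    exact: integrableZl (power_kernel_integrable x01).
  move=> t tx /=; rewrite normrM mulrC [X in _ * X]ger0_norm// ler_wpM2r// vM//.
  exact/itv01/(sub01 x01).
rewrite RintegralZl//; last exact: power_kernel_integrable.
by rewrite mulrC ler_wpM2r// Rintegral_power_kernel_le.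
Qed.

Lemma frac_intD u v x : bddmeas01 u -> bddmeas01 v -> 0 <= x <= 1 ->
  frac_int (fun t => u t + v t) x = frac_int u x + frac_int v x.
Proof.
move=> bu bv x01; rewrite /frac_int -RintegralD//; try exact: frac_integrable.
by apply: eq_Rintegral => t _; rewrite mulrDr.
Qed.

Lemma frac_intZ c v x : bddmeas01 v -> 0 <= x <= 1 ->
  frac_int (fun t => c * v t) x = c * frac_int v x.
Proof.
move=> bv x01; rewrite /frac_int -RintegralZl//; last exact: frac_integrable.
by apply: eq_Rintegral => t _; rewrite mulrCA.
Qed.

Lemma frac_int_ext u v x : 0 <= x <= 1 -> (forall x, 0 <= x <= 1 -> u x = v x) ->
  frac_int u x = frac_int v x.
Proof.
move=> x01 uv; apply: eq_Rintegral => t; rewrite inE => tx; rewrite uv//.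
exact/itv01/(sub01 x01).
Qed.

(** Tonelli's theorem gives measurability in x of the integral over all t of a nonnegative function
    of (x, t). The moving domain becomes a cut-off in the integrand, and [v] is extended by 0. *)
Let frac_measurable_ge0 v : bddmeas01 v -> (forall x, 0 <= x <= 1 -> 0 <= v x) ->
  measurable_fun (`[0, 1] : set R) (frac_int v).
Proof.
move=> [mv _] v0; pose v1 := v \_ `[0, 1].
have mv1 : measurable_fun setT v1 by apply/(measurable_restrictT v).
have v10 t : 0 <= v1 t.
  by rewrite /v1 patchE; case: ifPn => //; rewrite inE => /itv01; exact: v0.
pose f (z : R * R) : R := if z.2 <= z.1 then ker z.1 z.2 * v1 z.2 else 0.
have mf : measurable_fun setT f.
  apply: measurable_fun_ifT => //; first exact: measurable_fun_ler.
  apply: measurable_funM; last exact: measurableT_comp.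
  apply: (measurableT_comp (measurable_powR (g - 1))).
  exact: measurable_funB.
have f0 z : 0 <= f z by rewrite /f; case: ifP => // _; rewrite mulr_ge0.
have mF := measurable_fun_fubini_tonelli_F (m2 := mu) (EFin \o f).
have {}mF : measurable_fun setT (fun x => fine (\int[mu]_t (f (x, t))%:E)%E).
  by apply: measurableT_comp => //; apply: mF => //; apply/measurable_EFinP.
apply: (eq_measurable_fun _ _ (measurable_funTS mF)) => x; rewrite inE => /itv01 x01.
rewrite /frac_int [in RHS]/Rintegral [in RHS]integral_mkcond; congr fine.
apply: eq_integral => t _; rewrite patchE /f/=.
have [tx|xt] := leP t x; last first.
  by rewrite memNset//= in_itv/= [t <= x]leNgt xt andbF.
rewrite /v1 patchE; have [t0|t0] := leP 0 t; last first.
  by rewrite !memNset/= ?mulr0// in_itv/= [0 <= t]leNgt t0.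
by rewrite !mem_set//= in_itv/= t0//= (le_trans tx)//; case/andP: x01.
Qed.

(** Adding a bound [M] makes [v] nonnegative; linearity then reduces the signed case to the previous
    lemma. *)
Lemma frac_int_bddmeas01 v : bddmeas01 v -> bddmeas01 (frac_int v).
Proof.
move=> bv; have [mv [M vM]] := bv; split; last first.
  by exists (g^-1 * M) => x x01; exact: frac_int_le.
have bM := bddmeas01_cst M; have b := bddmeas01D bv bM.
have m1 : measurable_fun (`[0, 1] : set R) (frac_int (fun x => v x + M)).
  by apply: frac_measurable_ge0 => // x /vM; rewrite ler_norml; lra.
have m2 : measurable_fun (`[0, 1] : set R) (frac_int (fun=> M)).
  apply: frac_measurable_ge0 => // x x01; exact: le_trans (normr_ge0 _) (vM x x01).
apply: (eq_measurable_fun _ _ (measurable_funB m1 m2)) => x; rewrite inE => /itv01 x01.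
by rewrite /= frac_intD// addrK.
Qed.

End power_kernel.
End integrals.

(** * The Caputo derivative and the integral term as bounded operators *)

Section caputo_form.
Context {R : realType}.
Implicit Types (p q : {poly R}) (x t c M : R) (u v w : R -> R).
Local Notation mu := (@lebesgue_measure R).

(* The Caputo derivative as an operator on v = y^(m), for m = ceil alpha. *)
Definition capop (alpha : R) (m : nat) v x : R :=
  if alpha == m%:R then v x
  else (Gamma (m%:R - alpha))^-1 * frac_int (m%:R - alpha) v x.

Lemma absz_ceil (alpha : R) (m : nat) : m%:R - 1 < alpha <= m%:R ->
  `|Num.ceil alpha|%N = m.
Proof.
move=> am; rewrite (@ceil_def _ _ m%:Z)//.
by rewrite intrD -[m%:~R]/(m%:R) mulrN1z.
Qed.

Section operator.
Variables (alpha : R) (m : nat).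
Hypothesis am : m%:R - 1 < alpha <= m%:R.

Lemma caputoE y x : caputo alpha y x = capop alpha m (derive01n m y) x.
Proof. by rewrite /caputo /capop (absz_ceil am). Qed.

Let gap01 : alpha != m%:R -> 0 < m%:R - alpha < 1.
Proof.
by move=> ne; have /andP[h1] := am; rewrite le_eqVlt (negbTE ne)/= => h2; lra.
Qed.

Lemma capop_bddmeas01 v : bddmeas01 v -> bddmeas01 (capop alpha m v).
Proof.
move=> bv; rewrite /capop; case: eqVneq => [_|ne]; first exact: bddmeas01_ext bv.
exact: (bddmeas01M (bddmeas01_cst _) (frac_int_bddmeas01 (gap01 ne) bv)).
Qed.

Lemma capop_le : exists2 C, 0 <= C & forall v M x, bddmeas01 v -> 0 <= x <= 1 ->
  (forall x, 0 <= x <= 1 -> `|v x| <= M) -> `|capop alpha m v x| <= C * M.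
Proof.
rewrite /capop; case: eqVneq => [_|ne].
  by exists 1 => // v M x _ x01 vM; rewrite mul1r vM.
exists (`|(Gamma (m%:R - alpha))^-1| * (m%:R - alpha)^-1).
  by rewrite mulr_ge0// invr_ge0; case/andP: (gap01 ne) => /ltW.
move=> v M x bv x01 vM; rewrite normrM -mulrA ler_wpM2l//.
exact: (frac_int_le (gap01 ne) bv x01 vM).
Qed.

Lemma capopD u v x : bddmeas01 u -> bddmeas01 v -> 0 <= x <= 1 ->
  capop alpha m (fun t => u t + v t) x = capop alpha m u x + capop alpha m v x.
Proof.
move=> bu bv x01; rewrite /capop; case: eqVneq => // ne.
by rewrite (frac_intD (gap01 ne))// mulrDr.
Qed.

Lemma capopZ c v x : bddmeas01 v -> 0 <= x <= 1 ->
  capop alpha m (fun t => c * v t) x = c * capop alpha m v x.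
Proof.
move=> bv x01; rewrite /capop; case: eqVneq => // ne.
by rewrite (frac_intZ (gap01 ne))// mulrCA.
Qed.

Lemma capop_ext u v x : 0 <= x <= 1 -> (forall x, 0 <= x <= 1 -> u x = v x) ->
  capop alpha m u x = capop alpha m v x.
Proof.
move=> x01 uv; rewrite /capop; case: eqVneq => [_|ne]; first exact: uv.
by rewrite (frac_int_ext _ x01 uv).
Qed.

(** The integral term of the equation: [u] is the kernel at a fixed first variable, [v] the
    derivative of order m of the unknown. *)
Definition capform u v : R := \int[mu]_(s in `[0, 1]) (u s * capop alpha m v s).

Lemma capform_le : exists2 C, 0 <= C & forall u v (K M : R), bddmeas01 u -> bddmeas01 v ->
  (forall x, 0 <= x <= 1 -> `|u x| <= K) -> (forall x, 0 <= x <= 1 -> `|v x| <= M) ->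
  `|capform u v| <= K * (C * M).
Proof.
have [C C0 capC] := capop_le; exists C => // u v K M bu bv uK vM.
apply: Rintegral01_le; first by apply: bddmeas01M => //; exact: capop_bddmeas01.
by move=> x x01; rewrite normrM ler_pM ?uK ?capC.
Qed.

Lemma capformDl u w v : bddmeas01 u -> bddmeas01 w -> bddmeas01 v ->
  capform (fun s => u s + w s) v = capform u v + capform w v.
Proof.
move=> bu bw bv; have bc := capop_bddmeas01 bv.
rewrite /capform -RintegralD//; try by apply: bddmeas01_integrable; exact: bddmeas01M.
by apply: eq_Rintegral => s _; rewrite mulrDl.
Qed.

Lemma capformZl c u v : bddmeas01 u -> bddmeas01 v ->
  capform (fun s => c * u s) v = c * capform u v.
Proof.
move=> bu bv; have bc := capop_bddmeas01 bv.
rewrite /capform -RintegralZl//; last by apply: bddmeas01_integrable; exact: bddmeas01M.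
by apply: eq_Rintegral => s _; rewrite mulrA.
Qed.

(** Interpolation is a finite combination of node values, and [interp_kernel] moves it out of the
    integral by this lemma. Boundedness is carried along the induction because [capformDl] asks for
    it. *)
Lemma capform_suml (I : Type) (l : seq I) (c : I -> R) (F : I -> R -> R) v : bddmeas01 v ->
  (forall j, bddmeas01 (F j)) ->
  capform (fun s => \sum_(j <- l) c j * F j s) v = \sum_(j <- l) c j * capform (F j) v.
Proof.
move=> bv bF; suff [] : bddmeas01 (fun s => \sum_(j <- l) c j * F j s) /\
  capform (fun s => \sum_(j <- l) c j * F j s) v = \sum_(j <- l) c j * capform (F j) v by [].
elim: l => [|j l [IH1 IH2]].
  have -> : (fun s => \sum_(j <- [::]) c j * F j s) = (fun=> 0 * 0).
    by apply/funext => s; rewrite big_nil mulr0.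
  rewrite (capformZl 0 (u := fun=> 0)) ?big_nil ?mul0r//; last exact: bddmeas01_cst.
  by split=> //; exact: bddmeas01_cst.
have -> : (fun s => \sum_(j <- j :: l) c j * F j s) =
    (fun s => c j * F j s + \sum_(j <- l) c j * F j s).
  by apply/funext => s; rewrite big_cons.
have bj : bddmeas01 (fun s => c j * F j s) by apply: bddmeas01M => //; exact: bddmeas01_cst.
split; first exact: bddmeas01D.
by rewrite capformDl// capformZl// IH2 big_cons.
Qed.

Lemma capformDr u v w : bddmeas01 u -> bddmeas01 v -> bddmeas01 w ->
  capform u (fun s => v s + w s) = capform u v + capform u w.
Proof.
move=> bu bv bw; have b1 := capop_bddmeas01 bv; have b2 := capop_bddmeas01 bw.
rewrite /capform -RintegralD//; try by apply: bddmeas01_integrable; exact: bddmeas01M.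
by apply: eq_Rintegral => s; rewrite inE => /itv01 s01; rewrite capopD// mulrDr.
Qed.

Lemma capformZr c u v : bddmeas01 u -> bddmeas01 v ->
  capform u (fun s => c * v s) = c * capform u v.
Proof.
move=> bu bv; have bc := capop_bddmeas01 bv.
rewrite /capform -RintegralZl//; last by apply: bddmeas01_integrable; exact: bddmeas01M.
by apply: eq_Rintegral => s; rewrite inE => /itv01 s01; rewrite capopZ// mulrCA.
Qed.

Lemma capform_extr u v w : (forall x, 0 <= x <= 1 -> v x = w x) ->
  capform u v = capform u w.
Proof.
move=> vw; apply: eq_Rintegral => s; rewrite inE => /itv01 s01.
by rewrite (capop_ext s01 vw).
Qed.

Lemma bddmeas01_poly p : bddmeas01 (horner p).
Proof. by apply: continuous_bddmeas01; apply: continuous_subspaceT; exact: continuous_horner. Qed.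

End operator.

Section kernel.
Variables (k : R -> R -> R) (r : nat).
Hypothesis kr : Cn01sq r k.

Lemma kernel_bounded i : (i <= r)%N -> exists2 K, 0 <= K & forall t s,
  0 <= t <= 1 -> 0 <= s <= 1 -> `|partial01 i 0 k t s| <= K.
Proof.
move=> ir; have [_ _ /(_ i 0%N)] := kr; rewrite addn0 => /(_ ir) ck.
have c01 := @segment_compact R 0 1.
have /compact_bounded[M [_ H]] := continuous_compact ck (compact_setX c01 c01).
exists (`|M| + 1) => [|t s t01 s01]; first by rewrite addr_ge0.
apply: (H (`|M| + 1)); first by rewrite ltr_pwDr// ler_norm.
by exists (t, s) => //; split; exact/itv01.
Qed.

Lemma kernel_bddmeas01 i t : (i <= r)%N -> 0 <= t <= 1 -> bddmeas01 (partial01 i 0 k t).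
Proof.
move=> ir t01; apply: continuous_bddmeas01; have [_ _ /(_ i 0%N)] := kr.
rewrite addn0 => /(_ ir) /subspace_continuousP ck.
apply/subspace_continuousP => s s01.
have ts : (`[0, 1] `*` `[0, 1])%classic (t, s) by split=> //; exact/itv01.
apply/cvgrPdist_lt => e e0; have /cvgrPdist_lt/(_ e e0) := ck (t, s) ts.
rewrite !near_withinE => /nbhs_ballP[d /= d0 H]; apply/nbhs_ballP; exists d => // z sz z01.
apply: (H (t, z)); first by split=> //; exact: ballxx.
by split=> //; exact/itv01.
Qed.

Lemma kernel_der01 i s : (i < r)%N -> 0 <= s <= 1 ->
  der01 (fun t => partial01 i 0 k t s) (fun t => partial01 i.+1 0 k t s).
Proof.
by move=> ir s01 t t01; have [_ /(_ i 0%N t s)+ _] := kr; rewrite addn0; apply.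
Qed.

(** Differentiation under the integral sign: the Taylor remainder in t is quadratic uniformly in s,
    and the form is bounded. It takes the t-derivative of order i + 2, hence [i.+1 < r]. *)
Lemma capform_kernel_der01 (alpha : R) (m i : nat) v : m%:R - 1 < alpha <= m%:R ->
  bddmeas01 v -> (i.+1 < r)%N ->
  der01 (fun t => capform alpha m (partial01 i 0 k t) v)
        (fun t => capform alpha m (partial01 i.+1 0 k t) v).
Proof.
move=> am bv ir; have [C C0 capC] := capform_le am; have [_ [M vM]] := bv.
have [K K0 kK] := kernel_bounded ir.
have i1 : (i <= r)%N by rewrite ltnW// ltnW.
have i2 : (i.+1 <= r)%N by rewrite ltnW.
apply: (@der01_quadratic _ _ _ (K * (C * M))) => x y x01 y01.
have b0 := kernel_bddmeas01 i1 x01; have b1 := kernel_bddmeas01 i1 y01.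
have b2 := kernel_bddmeas01 i2 x01.
have bN : bddmeas01 (fun s => -1 * partial01 i 0 k x s) by apply: bddmeas01M => //; exact: bddmeas01_cst.
have bD : bddmeas01 (fun s => - (y - x) * partial01 i.+1 0 k x s) by apply: bddmeas01M => //; exact: bddmeas01_cst.
have -> : capform alpha m (partial01 i 0 k y) v - capform alpha m (partial01 i 0 k x) v -
    (y - x) * capform alpha m (partial01 i.+1 0 k x) v =
  capform alpha m (fun s => (partial01 i 0 k y s + -1 * partial01 i 0 k x s) +
    - (y - x) * partial01 i.+1 0 k x s) v.
  by rewrite capformDl ?capformZl// ?capformDl ?capformZl//; [ring | exact: bddmeas01D].
rewrite -mulrA [X in _ * X]mulrC mulrA.
apply: capC => //; first by apply: bddmeas01D => //; exact: bddmeas01D.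
move=> s s01; rewrite mulN1r mulNr.
apply: (der01_taylor (kernel_der01 (i := i) _ s01) (kernel_der01 (i := i.+1) _ s01)) => //.
by move=> t t01; exact: kK.
Qed.

End kernel.
End caputo_form.

(** * The discrete problem *)

Section discrete.
Context {R : realType}.
Implicit Types (p q P : {poly R}) (x t c M : R) (u v w : R -> R).
Local Notation mu := (@lebesgue_measure R).

Lemma size_legendre i : size (legendre i : {poly R}) = i.+1.
Proof.
suff : size (legendre i : {poly R}) = i.+1 /\ size (legendre i.+1 : {poly R}) = i.+2 by case.
elim: i => [|i [IH1 IH2]]; first by rewrite /= size_poly1 size_polyX.
split=> //; rewrite [legendre _]/(_ *: _) -/(legendre i) -/(legendre i.+1).
rewrite size_scale ?invr_eq0 ?pnatr_eq0//.
have s2 : size ((2 * i.+1 + 1)%:R *: ('X * legendre i.+1) : {poly R}) = i.+3.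
  by rewrite size_scale ?pnatr_eq0 ?addn1// mulrC size_mulX ?IH2// -size_poly_eq0 IH2.
by rewrite size_polyDl// s2 size_polyN (leq_ltn_trans (size_scale_leq _ _))// IH1.
Qed.

Lemma size_slegendre i : size (slegendre i : {poly R}) = i.+1.
Proof.
rewrite /slegendre size_comp_poly2 ?size_legendre// -polyC1.
by rewrite size_polyDl mul_polyC size_scale ?pnatr_eq0// size_polyX// size_polyN size_polyC oner_eq0.
Qed.

Lemma cheb_interp_ext N u v : (forall x, 0 <= x <= 1 -> u x = v x) ->
  cheb_interp N u = cheb_interp N v.
Proof.
by move=> uv; apply: eq_bigr => j _; rewrite uv//; exact: cheb_node01.
Qed.

Lemma cheb_interpD N u v :
  cheb_interp N (fun x => u x + v x) = cheb_interp N u + cheb_interp N v.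
Proof. by rewrite /cheb_interp -big_split/=; apply: eq_bigr => j _; rewrite scalerDl. Qed.

Lemma cheb_interpZ N c u : cheb_interp N (fun x => c * u x) = c *: cheb_interp N u.
Proof. by rewrite /cheb_interp scaler_sumr; apply: eq_bigr => j _; rewrite scalerA. Qed.

Lemma cheb_interp_horner N u t : exists c : 'I_N.+1 -> R, forall u,
  (cheb_interp N u).[t] = \sum_j c j * u (cheb_node N j).
Proof.
eexists => w; rewrite /cheb_interp horner_sum; apply: eq_bigr => j _.
by rewrite hornerZ mulrC.
Qed.

Section problem.
Variables (n m : nat) (a d : nat -> R) (alpha : R) (f : R -> R) (k : R -> R -> R) (r : nat).
Hypothesis am : m%:R - 1 < alpha <= m%:R.
Hypothesis kr : Cn01sq r k.

Local Notation form := (capform alpha m).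

(** Since interpolation in t commutes with integration in s, the discrete right-hand side is the
    interpolant of a single function. *)
Lemma interp_kernel N v t : bddmeas01 v ->
  \int[mu]_(s in `[0, 1]) ((cheb_interp N (k^~ s)).[t] * capop alpha m v s) =
  (cheb_interp N (fun x => form (k x) v)).[t].
Proof.
move=> bv; have [c cE] := cheb_interp_horner N (fun=> 0) t.
rewrite cE -(@capform_suml R alpha m am _ _ c (fun j => k (cheb_node N j)) v bv).
  by apply: eq_Rintegral => s _; rewrite cE.
by move=> j; apply: (kernel_bddmeas01 (i := 0) kr) => //; exact: cheb_node01.
Qed.

(** The tested Legendre polynomials span all polynomials of degree at most N - n, so the basis
    disappears from here on. *)
Lemma discrete_orthogonal N P q : cheb_legendre_approx n a d alpha f k N P ->
  (n <= N)%N -> (size q <= (N - n).+1)%N ->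
  pint ((diffop n a P - cheb_interp N f -
    cheb_interp N (fun t => form (k t) (horner P^`(m)))) * q) = 0.
Proof.
move=> [_ + _] nN sq => H.
have [|c ->] := @poly_span R slegendre (N - n) q _ sq.
  by move=> i _; exact: size_slegendre.
rewrite mulr_sumr pint_sum big1// => j _; rewrite -scalerAr pintZ.
have jN : (j + n <= N)%N by have := ltn_ord j; clear -nN; lia.
have := H j jN; rewrite !inner01_poly.
have -> : (fun t => \int[mu]_(s in `[0, 1]) ((cheb_interp N (k^~ s)).[t] * caputo alpha (horner P) s)) =
    horner (cheb_interp N (fun t => form (k t) (horner P^`(m)))).
  apply/funext => t; rewrite -interp_kernel; last exact: bddmeas01_poly.
  apply: eq_Rintegral => s; rewrite inE => /itv01 s01; rewrite (caputoE am); congr (_ * _).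
  by apply: capop_ext => // x x01; rewrite derive01n_poly.
rewrite inner01_poly -pintD.
have -> : \sum_(i < n.+1) a i * inner01 (horner P^`(i)) (horner (slegendre j)) =
    pint (diffop n a P * slegendre j).
  rewrite /diffop mulr_suml pint_sum; apply: eq_bigr => i _.
  by rewrite inner01_poly -scalerAl pintZ.
by rewrite !mulrBl !pintB pintD => ->; ring.
Qed.

Lemma approx_size N P : cheb_legendre_approx n a d alpha f k N P -> (size P <= N.+1)%N.
Proof.
move=> [[c ->] _ _]; rewrite (leq_trans (size_sum _ _ _))//; apply/bigmax_leqP => j _.
by rewrite (leq_trans (size_scale_leq _ _))// size_slegendre.
Qed.

(** Normalization multiplies the datum [f], whereas the integral term scales with [P] itself. *)
Lemma orthogonal_scaled N P c q : cheb_legendre_approx n a d alpha f k N P ->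
  (n <= N)%N -> (size q <= (N - n).+1)%N ->
  pint ((diffop n a (c *: P) - cheb_interp N
    (fun t => c * f t + form (k t) (horner (c *: P)^`(m)))) * q) = 0.
Proof.
move=> aP nN sq; rewrite cheb_interpD cheb_interpZ.
rewrite (@cheb_interp_ext N (fun t => form (k t) _)
  (fun t => c * form (k t) (horner P^`(m)))).
  rewrite cheb_interpZ.
  rewrite (_ : _ * q = c *: ((diffop n a P - cheb_interp N f -
    cheb_interp N (fun t => form (k t) (horner P^`(m)))) * q)).
    by rewrite pintZ (discrete_orthogonal aP)// mulr0.
  rewrite scalerAl !scalerBr opprD addrA; congr ((_ - _ - _) * _).
  by rewrite /diffop scaler_sumr; apply: eq_bigr => i _; rewrite derivnZ !scalerA mulrC.
move=> t t01; rewrite -(capformZr am); [|exact: (kernel_bddmeas01 (i := 0) kr)|exact: bddmeas01_poly].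
by apply: capform_extr => s _; rewrite derivnZ hornerZ.
Qed.

End problem.

Lemma derivn_derivn p i j : p^`(i)^`(j) = p^`(i + j).
Proof. by rewrite /derivn -iterD addnC. Qed.

Lemma uniform_choice n (A : nat -> R -> Prop) :
  (forall i K L, A i K -> K <= L -> A i L) ->
  (forall i, (i <= n)%N -> exists2 K, 0 <= K & A i K) ->
  exists2 K, 0 <= K & forall i, (i <= n)%N -> A i K.
Proof.
move=> mA; elim: n => [|n IH] H.
  by have [K K0 AK] := H 0%N (leqnn _); exists K => // i; rewrite leqn0 => /eqP->.
have [K K0 AK] := IH (fun i ni => H i (leqW ni)); have [L L0 AL] := H n.+1 (leqnn _).
exists (K + L); first exact: addr_ge0.
move=> i; rewrite leq_eqVlt => /predU1P[->|]; first by apply: mA AL _; rewrite lerDr.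
by rewrite ltnS => /AK AiK; apply: mA AiK _; rewrite lerDl.
Qed.

(** [superconvergence] at order 0 gives the equation up to [e]; at order Q it bounds the derivative
    of order [(maxn n m).+1], hence equicontinuity. Q depends only on n and m, and therefore so does
    [r]. *)
Lemma normalized_approx n m : exists r, forall (alpha : R) (a d : nat -> R)
    (f : R -> R) (k : R -> R -> R),
  m%:R - 1 < alpha <= m%:R -> a n != 0 -> Cn01 r f -> Cn01sq r k ->
  (forall e : R, 0 < e -> exists N1, forall N P c, (N1 <= N)%N -> 0 <= c <= 1 ->
    cheb_legendre_approx n a d alpha f k N P ->
    (forall i x, (i <= maxn n m)%N -> 0 <= x <= 1 -> `|(c *: P)^`(i).[x]| <= 1) ->
    forall x, 0 <= x <= 1 ->
      `|(diffop n a (c *: P)).[x] -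
        (c * f x + capform alpha m (k x) (horner (c *: P)^`(m)))| <= e) /\
  (exists C N1, forall N P c, (N1 <= N)%N -> 0 <= c <= 1 ->
    cheb_legendre_approx n a d alpha f k N P ->
    (forall i x, (i <= maxn n m)%N -> 0 <= x <= 1 -> `|(c *: P)^`(i).[x]| <= 1) ->
    forall i x, (i <= (maxn n m).+1)%N -> 0 <= x <= 1 -> `|(c *: P)^`(i).[x]| <= C).
Proof.
(* Differentiated Q times, the operator has leading term [a n] times the derivative of order M +
   1. *)
pose M := maxn n m; pose Q := (M.+1 - n)%N.
have [S super] := superconvergence (R := R) Q.
exists (Q + S + 2)%N => alpha a d f k am an0 fr kr; set r := (Q + S + 2)%N in fr kr.
have [C C0 capC] := capform_le am.
have [K K0 kK] : exists2 K : R, 0 <= K & forall i, (i <= Q + S)%N -> forall t s,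
    0 <= t <= 1 -> 0 <= s <= 1 -> `|partial01 i 0 k t s| <= K.
  apply: uniform_choice.
    by move=> i x y H xy t s t01 s01; exact: le_trans (H t s t01 s01) xy.
  by move=> i iQ; apply: (kernel_bounded kr); rewrite /r; clear -iQ; lia.
have [F F0 fF] : exists2 F : R, 0 <= F & forall i, (i <= Q + S)%N -> forall t,
    0 <= t <= 1 -> `|derive01n i f t| <= F.
  apply: uniform_choice.
    by move=> i x y H xy t t01; exact: le_trans (H t t01) xy.
  move=> i iQ; have ir : (i < r)%N by rewrite /r; clear -iQ; lia.
  have [_ [L Lf]] := continuous_bddmeas01 (der01_continuous (Cn01_der01 fr ir)).
  by exists L => //; apply: le_trans (normr_ge0 _) (Lf 0 _); rewrite lexx ler01.
(* Differentiation in t falls on [f] and [k] alone, so the bound 1 on the derivative of order m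
   suffices, and B is independent of N. *)
pose B := F + K * (C * 1).
have B0 : 0 <= B by rewrite addr_ge0// !mulr_ge0.
have key e : 0 < e -> exists N1, forall N P c, (N1 <= N)%N -> 0 <= c <= 1 ->
    cheb_legendre_approx n a d alpha f k N P ->
    (forall i x, (i <= maxn n m)%N -> 0 <= x <= 1 -> `|(c *: P)^`(i).[x]| <= 1) ->
    forall i x, (i <= Q)%N -> 0 <= x <= 1 ->
      `|(diffop n a (c *: P))^`(i).[x] - (c * derive01n i f x +
         capform alpha m (partial01 i 0 k x) (horner (c *: P)^`(m)))| <= e /\
      `|c * derive01n i f x +
         capform alpha m (partial01 i 0 k x) (horner (c *: P)^`(m))| <= B.
  move=> e0; have [N0 H] := super n a B e an0 B0 e0.
  exists (N0 + n)%N => N P c NN /andP[c0 c1] aP p1.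
  pose g i t := c * derive01n i f t +
    capform alpha m (partial01 i 0 k t) (horner (c *: P)^`(m)).
  have bp := bddmeas01_poly (c *: P)^`(m).
  have gB i x : (i <= Q + S)%N -> 0 <= x <= 1 -> `|g i x| <= B.
    move=> iQ x01; rewrite (le_trans (ler_normD _ _))// lerD//.
      by rewrite normrM ger0_norm// (le_trans (ler_wpM2l c0 (fF i iQ x x01)))// ler_piMl.
    apply: capC => //.
    - by apply: (kernel_bddmeas01 kr) => //; rewrite /r; clear -iQ; lia.
    - by move=> s s01; exact: kK.
    - by move=> s s01; apply: p1 => //; rewrite leq_maxr.
  move=> i x iQ x01; split; last by apply: gB => //; rewrite (leq_trans iQ)// leq_addr.
  apply: (H N (c *: P) g) => //.
  - by rewrite (leq_trans _ NN)// leq_addr.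
  - by rewrite (leq_trans (size_scale_leq _ _))// (approx_size aP).
  - by move=> j y jn; apply: p1; rewrite (leq_trans jn)// leq_maxl.
  - move=> j jQ; apply: der01D.
      by apply/der01Z/(Cn01_der01 fr); rewrite /r; clear -jQ; lia.
    by apply: (capform_kernel_der01 kr am) => //; rewrite /r; clear -jQ; lia.
  - move=> q sq; apply: (orthogonal_scaled am kr _ aP) => //.
    by rewrite (leq_trans _ NN)// leq_addl.
split.
  move=> e /key[N1 H]; exists N1 => N P c NN c01 aP p1 x x01.
  by have [] := H N P c NN c01 aP p1 0%N x (leq0n _) x01.
have [N1 H] := key 1 ltr01; have [A aA] := coef_bound n a.
have A0 : 0 <= A := le_trans (normr_ge0 _) (aA n (leqnn n)).
pose C1 := 1 + (1 + B + n%:R * A * 1) * `|(a n)^-1|.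
have C10 : 0 <= (1 + B + n%:R * A * 1) * `|(a n)^-1|.
  by rewrite mulr_ge0// !addr_ge0// !mulr_ge0.
exists C1, N1 => N P c NN c01 aP p1 i x iM x01; set p := c *: P.
move: iM; rewrite leq_eqVlt => /predU1P[->|iM]; last first.
  by rewrite (le_trans (p1 i x iM x01))// lerDl.
have [h1 h2] := H N P c NN c01 aP p1 Q x (leqnn _) x01; rewrite -/p in h1 h2.
have nM : (n <= M)%N by exact: leq_maxl.
have e : (diffop n a p)^`(Q).[x] =
    \sum_(i < n) a i * p^`(i + Q).[x] + a n * p^`(M.+1).[x].
  rewrite diffopE derivnD hornerD derivnZ hornerZ linear_sum horner_sum; congr (_ + _ * _).
    by apply: eq_bigr => j _; rewrite linearZ hornerZ /= derivn_derivn.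
  rewrite derivn_derivn; congr (p^`(_).[_]).
  by rewrite /Q subnKC// (leq_trans nM).
have -> : p^`(M.+1).[x] = ((diffop n a p)^`(Q).[x] - \sum_(i < n) a i * p^`(i + Q).[x]) * (a n)^-1.
  by rewrite e addrAC subrr add0r mulrAC mulfV// mul1r.
rewrite normrM /C1 (le_trans (ler_wpM2r _ (_ : _ <= 1 + B + n%:R * A * 1))) ?lerDr//.
rewrite (le_trans (ler_normB _ _))// lerD//.
  rewrite -[X in `|X|](subrK (c * derive01n Q f x +
    capform alpha m (partial01 Q 0 k x) (horner p^`(m)))).
  by rewrite (le_trans (ler_normD _ _))// lerD.
apply: (sum_norm_le (u := fun i => p^`(i + Q).[x])) => j jn; first by rewrite aA// ltnW.
by apply: p1 => //; rewrite -/M /Q; clear -jn nM; lia.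
Qed.

End discrete.

(** * Limits along an ultrafilter *)

Section ultralimits.
Context {R : realType} (U : set_system nat) {UU : UltraFilter U}.
Implicit Types (h : nat -> R) (F : nat -> R -> R) (l e a B D C : R).

Lemma near_const_le a B D : 0 <= D ->
  (forall e, 0 < e -> \forall N \near U, a <= B + D * e) -> a <= B.
Proof.
move=> D0 H; apply/ler_addgt0Pr => e e0.
have D1 : 0 < D + 1 by rewrite ltr_wpDl.
have [N] := filter_ex (H _ (divr_gt0 e0 D1)).
move=> /le_trans; apply; rewrite lerD2l mulrA ler_pdivrMr// mulrC ler_wpM2l ?(ltW e0)//.
by rewrite lerDl.
Qed.

(** Compactness of [-C, C] gives a cluster point, which for an ultrafilter is a limit. *)
Lemma ultra_limit h C : (\forall N \near U, `|h N| <= C) ->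
  exists l, forall e, 0 < e -> \forall N \near U, `|h N - l| <= e.
Proof.
move=> hC; pose G : set_system R := fun A => U (h @^-1` A).
have PG : ProperFilter G by exact: fmap_proper_filter.
have GC : G `[- C, C]%classic.
  by apply: filterS hC => N; rewrite ler_norml /= in_itv.
have [l [_ cl]] := @segment_compact R (- C) C G PG GC.
exists l => e e0; have [//|nU] := in_ultra_setVsetC [set N | `|h N - l| <= e] UU.
have [|t [tA tB]] := cl (~` [set x | `|x - l| <= e]) (ball l e) nU.
  exact: nbhsx_ballx.
by case: tA => /=; move: tB; rewrite /ball/= distrC => /ltW.
Qed.

Lemma ultra_lipschitz F (E : R -> R) C :
  (\forall N \near U, forall x y : R, 0 <= x <= 1 -> 0 <= y <= 1 ->
    `|F N y - F N x| <= C * `|y - x|) ->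
  (forall x : R, 0 <= x <= 1 -> forall e, 0 < e -> \forall N \near U, `|F N x - E x| <= e) ->
  forall x y : R, 0 <= x <= 1 -> 0 <= y <= 1 -> `|E y - E x| <= C * `|y - x|.
Proof.
move=> FL FE x y x01 y01; apply: (@near_const_le _ _ 2) => // e e0.
apply: filterS3 FL (FE x x01 e e0) (FE y y01 e e0) => N /(_ x y x01 y01).
rewrite !ler_norml => /andP[? ?] /andP[? ?] /andP[? ?].
by apply/andP; split; lra.
Qed.

(** The Arzela-Ascoli argument. Otherwise there are points x_N with error above [e]; they tend to
    some z along U, and the two oscillations between x_N and z together with the error at z amount
    to at most 3e/4. *)
Lemma ultra_uniform F (E : R -> R) C :
  (\forall N \near U, forall x y : R, 0 <= x <= 1 -> 0 <= y <= 1 ->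
    `|F N y - F N x| <= C * `|y - x|) ->
  (forall x : R, 0 <= x <= 1 -> forall e, 0 < e -> \forall N \near U, `|F N x - E x| <= e) ->
  forall e, 0 < e -> \forall N \near U, forall x : R, 0 <= x <= 1 -> `|F N x - E x| <= e.
Proof.
move=> FL FE e e0; have EL := ultra_lipschitz FL FE.
have [//|nU] := in_ultra_setVsetC [set N | forall x : R, 0 <= x <= 1 -> `|F N x - E x| <= e] UU.
have /choice[x xP] : forall N, exists x : R, 0 <= x <= 1 /\
    ((exists2 y : R, 0 <= y <= 1 & e < `|F N y - E y|) -> e < `|F N x - E x|).
  move=> N; have [[y y01 ye]|H] := pselect (exists2 y : R, 0 <= y <= 1 & e < `|F N y - E y|).
    by exists y.
  by exists 0; rewrite lexx ler01.
have [z zP] : exists z : R, forall d : R, 0 < d -> \forall N \near U, `|x N - z| <= d.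
  apply: (@ultra_limit x 1); apply: nearW => N.
  by have [/andP[x0 x1] _] := xP N; rewrite ger0_norm.
have z01 : 0 <= z <= 1.
  apply/andP; split.
    rewrite -oppr_le0; apply: (@near_const_le _ _ 1) => // d d0.
    apply: filterS (zP d d0) => N; have [/andP[x0 x1] _] := xP N.
    by rewrite ler_norml; lra.
  apply: (@near_const_le _ _ 1) => // d d0.
  apply: filterS (zP d d0) => N; have [/andP[x0 x1] _] := xP N.
  by rewrite ler_norml; lra.
have C1 : 0 < `|C| + 1 by rewrite ltr_wpDl.
pose d := e / 4 / (`|C| + 1); have d0 : 0 < d by rewrite !divr_gt0.
have Cd (u : R) : `|u| <= d -> C * `|u| <= e / 4.
  rewrite /d ler_pdivlMr// => ud; apply: le_trans ud; rewrite mulrC ler_wpM2l//.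
  by rewrite (le_trans (ler_norm _))// lerDl.
have e4 : 0 < e / 4 by rewrite divr_gt0.
have [N [[NL NU] [Nz NF]]] := filter_ex (filterI (filterI FL nU) (filterI (zP d d0) (FE z z01 _ e4))).
have [x01 xe] := xP N.
have : e < `|F N (x N) - E (x N)|.
  apply: xe; apply: contrapT => H; apply: NU => y y01; rewrite leNgt; apply/negP => ye.
  by apply: H; exists y.
have h1 := le_trans (NL z (x N) z01 x01) (Cd _ Nz).
have h2 := le_trans (EL z (x N) z01 x01) (Cd _ Nz).
rewrite ltNge => /negP[]; move: h1 h2 NF; rewrite !ler_norml => /andP[? ?] /andP[? ?] /andP[? ?].
by apply/andP; split; lra.
Qed.

End ultralimits.

(** * Norms and solutions of the continuous problem *)

Section solutions.
Context {R : realType}.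
Implicit Types (p q : {poly R}) (x y t e B C : R) (u v w z : R -> R).

Lemma lipschitz_continuous01 v C :
  (forall x y : R, 0 <= x <= 1 -> 0 <= y <= 1 -> `|v y - v x| <= C * `|y - x|) ->
  {within `[0, 1], continuous v}.
Proof.
move=> vC; apply/subspace_continuousP => x; rewrite /= in_itv/= => x01.
apply/cvgrPdist_lt => e e0; rewrite near_withinE; apply/nbhs_ballP.
have C1 : 0 < `|C| + 1 by rewrite ltr_wpDl.
exists (e / (`|C| + 1)) => /=; first exact: divr_gt0.
move=> t; rewrite /ball/= ltr_pdivlMr// => td; rewrite in_itv/= => t01.
apply: le_lt_trans (vC _ _ t01 x01) _; apply: le_lt_trans td.
by rewrite [leRHS]mulrC ler_wpM2r// (le_trans (ler_norm _))// lerDl.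
Qed.

Lemma continuous01_ext u v : (forall x, 0 <= x <= 1 -> u x = v x) ->
  {within `[0, 1], continuous u} -> {within `[0, 1], continuous v}.
Proof.
move=> uv /subspace_continuousP cu; apply/subspace_continuousP => x x01.
apply/cvgrPdist_lt => e e0; have /cvgrPdist_lt/(_ e e0) := cu x x01.
rewrite !near_withinE; apply: filterS => t H t01.
have := H t01; rewrite /from_subspace/= !uv//; exact/itv01.
Qed.

Lemma Cn01_continuous r v i : Cn01 r v -> (i <= r)%N ->
  {within `[0, 1], continuous (derive01n i v)}.
Proof.
move=> vr; rewrite leq_eqVlt => /predU1P[->|ir]; first by case: vr.
exact: der01_continuous (Cn01_der01 vr ir).
Qed.

Lemma L2norm01_le u B : bddmeas01 u -> 0 <= B -> (forall x, 0 <= x <= 1 -> `|u x| <= B) ->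
  L2norm01 u <= B.
Proof.
move=> bu B0 uB; rewrite /L2norm01 -[leRHS]ger0_norm// -sqrtr_sqr ler_wsqrtr// (le_trans (ler_norm _))//.
apply: Rintegral01_le; first exact: bddmeas01M.
by move=> x /uB ux; rewrite normrM expr2 ler_pM.
Qed.

(** [b] is the C^M norm raised to at least 1, so that 1/b <= 1. The last clause stands in for an
    attained maximum: unless b <= 2, some derivative of the normalized polynomial has size at least
    1/2 somewhere, which keeps the limit from vanishing. *)
Lemma poly_norm_bound p M : exists b : R, [/\ 1 <= b,
  forall i x, (i <= M)%N -> 0 <= x <= 1 -> `|p^`(i).[x]| <= b &
  b <= 2 \/ exists i x, [/\ (i <= M)%N, 0 <= x <= 1 & b <= 2 * `|p^`(i).[x]|]].
Proof.
have [K K0 pK] : exists2 K : R, 0 <= K & forall i, (i <= M)%N -> forall x,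
    0 <= x <= 1 -> `|p^`(i).[x]| <= K.
  apply: uniform_choice.
    by move=> i x y H xy t t01; exact: le_trans (H t t01) xy.
  move=> i _; have [_ [L Lf]] := bddmeas01_poly p^`(i).
  by exists L => //; apply: le_trans (normr_ge0 _) (Lf 0 _); rewrite lexx ler01.
pose E : set R := [set z | z = 1 \/ exists i x, [/\ (i <= M)%N, 0 <= x <= 1 & z = `|p^`(i).[x]|]].
have uE : has_ubound E.
  exists (1 + K) => z [->|[i [x [iM x01 ->]]]]; first by rewrite lerDl.
  by rewrite (le_trans (pK i iM x x01))// lerDr.
have E1 : E 1 by left.
have sE : has_sup E by split => //; exists 1.
have s1 : 1 <= sup E by exact: (ub_le_sup uE).
exists (sup E); split=> //.
  by move=> i x iM x01; apply: (ub_le_sup uE); right; exists i, x.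
have s0 : 0 < sup E / 2 by rewrite divr_gt0// (lt_le_trans ltr01).
have [z [->|[i [x [iM x01 ->]]]] h] := sup_adherent s0 sE; [left | right].
  by lra.
by exists i, x; split=> //; lra.
Qed.

Section chains.
Variables (n m : nat) (a d : nat -> R) (alpha : R) (f : R -> R) (k : R -> R -> R).
Hypothesis am : m%:R - 1 < alpha <= m%:R.

Lemma capform_caputo u (z : R -> R) :
  \int[@lebesgue_measure R]_(s in `[0, 1]) (u s * caputo alpha z s) =
  capform alpha m u (derive01n m z).
Proof. by apply: eq_Rintegral => s _; rewrite (caputoE am). Qed.

Lemma fide_solution_chain z (G : nat -> R -> R) :
  (forall x, 0 <= x <= 1 -> z x = G 0%N x) ->
  (forall i, (i < maxn n m)%N -> der01 (G i) (G i.+1)) ->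
  {within `[0, 1], continuous (G (maxn n m))} ->
  (forall t, 0 <= t <= 1 ->
    \sum_(i < n.+1) a i * G i t = f t + capform alpha m (k t) (G m)) ->
  (forall i, (i < n)%N -> G i 0 = d i) ->
  fide_solution n a d alpha f k z.
Proof.
move=> zG dG cG eqG iG; have [H1 H2] := derive01n_chain zG dG.
rewrite /fide_solution (absz_ceil am); split.
- split=> [i x iM x01|]; first exact: H2.
  by apply: continuous01_ext cG => x x01; rewrite H1.
- move=> t t01; under eq_bigr => i _.
    rewrite H1//; last by rewrite (leq_trans _ (leq_maxl _ _))// -ltnS.
    over.
  rewrite (eqG t t01) capform_caputo; congr (f t + _).
  by apply: capform_extr => x x01; rewrite H1// leq_maxr.
- by move=> i ni; rewrite H1 ?iG ?lexx ?ler01// (leq_trans (ltnW ni))// leq_maxl.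
Qed.

Lemma fide_solutionP (y : R -> R) : fide_solution n a d alpha f k y ->
  [/\ Cn01 (maxn n m) y,
    forall t, 0 <= t <= 1 -> \sum_(i < n.+1) a i * derive01n i y t =
      f t + capform alpha m (k t) (derive01n m y) &
    forall i, (i < n)%N -> derive01n i y 0 = d i].
Proof.
rewrite /fide_solution (absz_ceil am) => -[H1 H2 H3]; split=> // t /H2 ->.
by rewrite capform_caputo.
Qed.

End chains.
End solutions.

Lemma ler_norm4 (R : realType) (u v w z a b c d : R) :
  `|u| <= a -> `|v| <= b -> `|w| <= c -> `|z| <= d -> `|u - v + w + z| <= a + b + c + d.
Proof.
move=> ua vb wc zd; rewrite (le_trans (ler_normD _ _))// lerD//.
by rewrite (le_trans (ler_normD _ _))// lerD// (le_trans (ler_normB _ _))// lerD.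
Qed.

Section limit_solution.
Context {R : realType} (U : set_system nat) {UU : UltraFilter U}.
Variables (n m : nat) (alpha : R) (a d : nat -> R) (f : R -> R) (k : R -> R -> R).
Variables (r : nat) (C : R) (c : nat -> R) (p : nat -> {poly R}).
Hypothesis am : m%:R - 1 < alpha <= m%:R.
Hypothesis kr : Cn01sq r k.
Hypothesis c01 : forall N, 0 <= c N <= 1.
Local Notation M := (maxn n m).
Hypothesis pC : \forall N \near U, forall i (x : R), (i <= M.+1)%N -> 0 <= x <= 1 ->
  `|(p N)^`(i).[x]| <= C.
Hypothesis p_eq : forall e : R, 0 < e -> \forall N \near U, forall x : R, 0 <= x <= 1 ->
  `|(diffop n a (p N)).[x] - (c N * f x + capform alpha m (k x) (horner (p N)^`(m)))| <= e.
Hypothesis p_ini : \forall N \near U, forall i, (i < n)%N -> (p N)^`(i).[0] = c N * d i.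

Lemma limit_solution : exists (b : R) (E : nat -> R -> R),
  [/\ 0 <= b /\ (forall e : R, 0 < e -> \forall N \near U, `|c N - b| <= e),
      forall e : R, 0 < e -> \forall N \near U, forall i (x : R), (i <= M)%N ->
        0 <= x <= 1 -> `|(p N)^`(i).[x] - E i x| <= e,
      (forall i, (i < M)%N -> der01 (E i) (E i.+1)) /\
      (forall i, (i <= M)%N -> {within `[0, 1], continuous (E i)}),
      forall t : R, 0 <= t <= 1 ->
        \sum_(i < n.+1) a i * E i t = b * f t + capform alpha m (k t) (E m) &
      forall i, (i < n)%N -> E i 0 = b * d i].
Proof.
have [b bP] : exists b : R, forall e : R, 0 < e -> \forall N \near U, `|c N - b| <= e.
  apply: (@ultra_limit _ _ _ c 1); apply: nearW => N.
  by have /andP[c0 c1] := c01 N; rewrite ger0_norm.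
have b0 : 0 <= b.
  rewrite -oppr_le0; apply: (@near_const_le _ U _ _ _ 1) => // e e0.
  by apply: filterS (bP e e0) => N; have /andP[c0 c1] := c01 N; rewrite ler_norml; lra.
(* A single choice over pairs (i, x) defines all limits; 0 fills in outside the relevant range. *)
have /choice[E' E'P] : forall ix : nat * R, exists l : R, (ix.1 <= M)%N ->
    0 <= ix.2 <= 1 -> forall e : R, 0 < e ->
      \forall N \near U, `|(p N)^`(ix.1).[ix.2] - l| <= e.
  move=> [i x] /=; have [iM|iM] := leqP i M; last by exists 0.
  have [x01|x01] := boolP (0 <= x <= 1); last by exists 0.
  have H : \forall N \near U, `|(p N)^`(i).[x]| <= C.
    by apply: filterS pC => N; apply=> //; exact: leqW.
  have [l lP] := @ultra_limit _ U UU (fun N => (p N)^`(i).[x]) C H.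
  by exists l.
pose E i x := E' (i, x).
have EP i x : (i <= M)%N -> 0 <= x <= 1 -> forall e : R, 0 < e ->
    \forall N \near U, `|(p N)^`(i).[x] - E i x| <= e.
  by move=> iM x01; exact: (E'P (i, x)).
have pL i : (i <= M)%N -> \forall N \near U, forall x y : R, 0 <= x <= 1 -> 0 <= y <= 1 ->
    `|(p N)^`(i).[y] - (p N)^`(i).[x]| <= C * `|y - x|.
  move=> iM; apply: filterS pC => N pNC; apply: poly_lipschitz => t t01.
  by rewrite -derivnS pNC.
have unif i : (i <= M)%N -> forall e : R, 0 < e -> \forall N \near U, forall x : R,
    0 <= x <= 1 -> `|(p N)^`(i).[x] - E i x| <= e.
  move=> iM; apply: (@ultra_uniform _ U UU (fun N x => (p N)^`(i).[x]) (E i) C).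
    exact: pL.
  by move=> x x01; exact: EP.
have EL i : (i <= M)%N -> forall x y : R, 0 <= x <= 1 -> 0 <= y <= 1 ->
    `|E i y - E i x| <= C * `|y - x|.
  move=> iM; apply: (@ultra_lipschitz _ U UU (fun N x => (p N)^`(i).[x])).
    exact: pL.
  by move=> x x01; exact: EP.
have cE i : (i <= M)%N -> {within `[0, 1], continuous (E i)}.
  by move=> iM; exact: lipschitz_continuous01 (EL i iM).
exists b, E; split=> //.
- move=> e e0.
  have H : \forall N \near U, forall i : 'I_M.+1, forall x : R,
      0 <= x <= 1 -> `|(p N)^`(i).[x] - E i x| <= e.
    by apply: filter_forall => i; apply: unif => //; rewrite -ltnS.
  apply: filterS H => N H i x iM x01.
  by have := H (Ordinal (iM : (i < M.+1)%N)) x x01.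
(* Taylor's inequality with constant C passes to the limit. It involves the order i + 2 <= M + 1,
   which is where the additional derivative in [pC] is used. *)
- split=> // i iM; apply: (@der01_quadratic _ _ _ C) => x y x01 y01.
  apply: (@near_const_le _ U _ _ _ 3) => // e e0.
  have h1 := EP i x (ltnW iM) x01 e e0; have h2 := EP i y (ltnW iM) y01 e e0.
  have h3 := EP i.+1 x iM x01 e e0.
  apply: filterS2 (filterI h1 h2) (filterI h3 pC) => N [{}h1 {}h2] [{}h3 pNC].
  have := der01_taylor (@der01_poly _ (p N)^`(i)) (@der01_poly _ (p N)^`(i)^`()) (L := C) _ x01 y01.
  rewrite -!derivnS => /(_ _)/wrap[|].
    by move=> t t01; apply: pNC.
  move=> T; have yx : `|(y - x) * ((p N)^`(i.+1).[x] - E i.+1 x)| <= e.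
    rewrite normrM (le_trans _ h3)// ler_piMl// ler_norml.
    by move: x01 y01 => /andP[? ?] /andP[? ?]; apply/andP; split; lra.
  rewrite [X in `|X|](_ : _ = ((p N)^`(i).[y] - (p N)^`(i).[x] - (y - x) * (p N)^`(i.+1).[x])
    - ((p N)^`(i).[y] - E i y) + ((p N)^`(i).[x] - E i x)
    + (y - x) * ((p N)^`(i.+1).[x] - E i.+1 x)); last by ring.
  apply: le_trans (ler_norm4 T h2 h1 yx) _.
  by rewrite -!addrA lerD2l le_eqVlt; apply/orP; left; apply/eqP; ring.
- move=> t t01; apply/eqP; rewrite -subr_eq0 -normr_le0.
  have [C' C'0 capC] := capform_le am; have [K K0 kK] := kernel_bounded kr (leq0n r).
  have [A aA] := coef_bound n a.
  have A0 : 0 <= A := le_trans (normr_ge0 _) (aA n (leqnn n)).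
  apply: (@near_const_le _ U _ _ _ (n.+1%:R * A + 1 + `|f t| + K * C')).
    by rewrite !addr_ge0 ?mulr_ge0.
  move=> e e0; have mM : (m <= M)%N := leq_maxr _ _.
  have h1 : \forall N \near U, forall i : 'I_n.+1, `|(p N)^`(i).[t] - E i t| <= e.
    by apply: filter_forall => i; apply: EP => //; rewrite (leq_trans _ (leq_maxl _ _))// -ltnS.
  apply: filterS2 (filterI h1 (p_eq e0)) (filterI (bP e e0) (unif m mM e e0)).
  move=> N [{}h1 h2] [h3 h4].
  have bk := kernel_bddmeas01 kr (leq0n r) t01.
  have bEm : bddmeas01 (E m) by apply: continuous_bddmeas01; exact: cE.
  have bp := bddmeas01_poly (p N)^`(m).
  have bmE : bddmeas01 (fun s => -1 * E m s) by apply: bddmeas01M => //; exact: bddmeas01_cst.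
  have h5 : `|capform alpha m (k t) (horner (p N)^`(m)) - capform alpha m (k t) (E m)| <= K * (C' * e).
    rewrite -[- capform _ _ _ _]mulN1r -capformZr// -capformDr//; apply: capC => //.
    - exact: bddmeas01D.
    - by move=> s s01; exact: kK.
    - by move=> s s01; rewrite mulN1r h4.
  have h6 : `|\sum_(i < n.+1) a i * ((p N)^`(i).[t] - E i t)| <= n.+1%:R * A * e.
    apply: (sum_norm_le (u := fun i => (p N)^`(i).[t] - E i t)) => i ni; first exact: aA.
    exact: (h1 (Ordinal ni)).
  have h7 : `|(c N - b) * f t| <= `|f t| * e by rewrite normrM mulrC ler_wpM2l.
  have := h2 t t01; rewrite /diffop (horner_lincomb n.+1 a (derivn^~ (p N))) => {}h2.
  rewrite [X in `|X|](_ : _ = (\sum_(i < n.+1) a i * (p N)^`(i).[t] -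
      (c N * f t + capform alpha m (k t) (horner (p N)^`(m))))
    - \sum_(i < n.+1) a i * ((p N)^`(i).[t] - E i t) + (c N - b) * f t
    + (capform alpha m (k t) (horner (p N)^`(m)) - capform alpha m (k t) (E m))); last first.
    by under [X in _ - X + _]eq_bigr do rewrite mulrBr; rewrite sumrB; ring.
  apply: le_trans (ler_norm4 h2 h6 h7 h5) _.
  by rewrite add0r le_eqVlt; apply/orP; left; apply/eqP; ring.
- move=> i ni; apply/eqP; rewrite -subr_eq0 -normr_le0.
  apply: (@near_const_le _ U _ _ _ (1 + `|d i|)); first by rewrite addr_ge0.
  have iM : (i <= M)%N by rewrite (leq_trans (ltnW ni))// leq_maxl.
  move=> e e0; have h1 := EP i 0 iM _ e e0; rewrite lexx ler01 in h1.
  apply: filterS3 p_ini (h1 isT) (bP e e0) => N /(_ i ni) -> {}h1 h2.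
  rewrite add0r (_ : _ - _ = (c N - b) * d i - (c N * d i - E i 0)); last by ring.
  rewrite (le_trans (ler_normB _ _))// [leRHS]mulrDl mul1r [leRHS]addrC lerD//.
  by rewrite normrM mulrC ler_wpM2l.
Qed.

End limit_solution.

(** * Identification of the limit by uniqueness *)

Lemma chain_zero (R : realType) (G : nat -> R -> R) M :
  (forall i, (i < M)%N -> der01 (G i) (G i.+1)) ->
  (forall x : R, 0 <= x <= 1 -> G 0%N x = 0) ->
  forall i (x : R), (i <= M)%N -> 0 <= x <= 1 -> G i x = 0.
Proof.
move=> dG G0 i x iM x01.
have [h1 _] := derive01n_chain (z := G 0%N) (fun _ _ => erefl) dG.
have dz : der01 (fun=> 0 : R) (fun=> 0 : R).
  apply: (@der01_quadratic _ _ _ 0) => y z _ _.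
  by rewrite mulr0 !subrr normr0 mul0r.
have [h2 _] := derive01n_chain (G := fun _ _ => 0) (M := M) G0 (fun _ _ => dz).
by rewrite -h1// h2.
Qed.

Lemma continuous01D (R : realType) (u v : R -> R) :
  {within `[0, 1], continuous u} -> {within `[0, 1], continuous v} ->
  {within `[0, 1], continuous (fun x => u x + v x)}.
Proof. by move=> cu cv x; apply: continuousD; [exact: cu | exact: cv]. Qed.

Lemma continuous01Z (R : realType) (c : R) (v : R -> R) :
  {within `[0, 1], continuous v} -> {within `[0, 1], continuous (fun x => c * v x)}.
Proof.
move=> cv x; apply: continuousM; last exact: cv.
exact: cst_continuous.
Qed.

(** Each ultrafilter finer than the filter at infinity is treated by itself: the limit of the
    normalizing factors may depend on it, the conclusion does not. *)
Lemma ultra_L2 (R : realType) (n m : nat) : exists r : nat,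
  forall (alpha : R) (a d : nat -> R) (f : R -> R) (k : R -> R -> R)
    (y : R -> R) (yN : nat -> {poly R}) (N0 : nat) (U : set_system nat),
  UltraFilter U -> \oo `<=` U ->
  m%:R - 1 < alpha <= m%:R -> a n != 0 -> Cn01 r f -> Cn01sq r k ->
  fide_solution n a d alpha f k y ->
  (forall z : R -> R, fide_solution n a d alpha f k z ->
     forall t, 0 <= t <= 1 -> z t = y t) ->
  (forall N, (N0 <= N)%N -> cheb_legendre_approx n a d alpha f k N (yN N)) ->
  forall e : R, 0 < e -> \forall N \near U, L2norm01 (fun x => y x - (yN N).[x]) <= e.
Proof.
have [r normalized] := @normalized_approx R n m; exists r.
move=> alpha a d f k y yN N0 U UU ooU am an0 fr kr ysol yuniq approx e e0.
have [super [C [N1 bnd]]] := normalized alpha a d f k am an0 fr kr.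
set M := maxn n m in super bnd *.
have big K : \forall N \near U, (K <= N)%N by apply: ooU; exact: nbhs_infty_ge.
have /choice[b bP] := fun N => poly_norm_bound (yN N) M.
pose c N := (b N)^-1; pose p N := c N *: yN N.
have b1 N : 1 <= b N by have [] := bP N.
have b0 N : 0 < b N := lt_le_trans ltr01 (b1 N).
have c0 N : 0 < c N by rewrite invr_gt0.
have c01 N : 0 <= c N <= 1 by rewrite ltW//= invf_le1.
have p1 N i x : (i <= M)%N -> 0 <= x <= 1 -> `|(p N)^`(i).[x]| <= 1.
  move=> iM x01; rewrite derivnZ hornerZ normrM gtr0_norm// mulrC ler_pdivrMr// mul1r.
  by have [_ H _] := bP N; exact: H.
have pC : \forall N \near U, forall i (x : R), (i <= M.+1)%N -> 0 <= x <= 1 ->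
    `|(p N)^`(i).[x]| <= C.
  apply: filterS2 (big N0) (big N1) => N h0 h1 i x iM x01.
  exact: (bnd N (yN N) (c N) h1 (c01 N) (approx N h0) (@p1 N)).
have p_eq (e' : R) : 0 < e' -> \forall N \near U, forall x : R, 0 <= x <= 1 ->
    `|(diffop n a (p N)).[x] -
      (c N * f x + capform alpha m (k x) (horner (p N)^`(m)))| <= e'.
  move=> /super[N2 H]; apply: filterS2 (big N0) (big N2) => N h0 h2.
  exact: (H N (yN N) (c N) h2 (c01 N) (approx N h0) (@p1 N)).
have p_ini : \forall N \near U, forall i, (i < n)%N -> (p N)^`(i).[0] = c N * d i.
  apply: filterS (big N0) => N /approx[_ _ H] i ni.
  by rewrite derivnZ hornerZ H.
have [be [E [[be0 cb] unif [dE cE] eqE iE]]] := limit_solution am kr c01 pC p_eq p_ini.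
have [yr eqy iy] := fide_solutionP am ysol.
have nM : (n <= M)%N := leq_maxl _ _; have mM : (m <= M)%N := leq_maxr _ _.
have cy i : (i <= M)%N -> {within `[0, 1], continuous (derive01n i y)}.
  exact: Cn01_continuous.
have bk t : 0 <= t <= 1 -> bddmeas01 (k t) by exact: (kernel_bddmeas01 (i := 0) kr).
have bEm : bddmeas01 (E m) by apply: continuous_bddmeas01; exact: cE.
(* If [be = 0], the limit solves the homogeneous problem. Uniqueness is given for the data [f], [d]
   only, so it is applied to the sum of [y] and this limit. *)
move: be0; rewrite le_eqVlt => /predU1P[be0|be0].
  have E0 (x : R) : 0 <= x <= 1 -> E 0%N x = 0.
    have sol : fide_solution n a d alpha f k (fun x => y x + E 0%N x); last first.
      by move=> x01; apply: (addrI (y x)); rewrite addr0; exact: (yuniq _ sol x x01).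
    refine (fide_solution_chain am (G := fun i x => derive01n i y x + E i x)
      (fun _ _ => erefl) _ _ _ _).
    - by move=> i iM; apply: der01D; [exact: Cn01_der01 yr iM | exact: dE].
    - by apply: continuous01D; [exact: cy | exact: cE].
    - move=> t t01; under eq_bigr do rewrite mulrDr.
      rewrite big_split/= eqy// eqE// -be0 mul0r add0r -addrA; congr (_ + _).
      by rewrite capformDr//; [exact: bk | apply: continuous_bddmeas01; exact: cy].
    - by move=> i ni; rewrite iy// iE// -be0 mul0r addr0.
  (* With 1/4 for both errors, [b N] is at least 4, which rules out b <= 2, and the normalized
     derivatives are at most 1/4, against the value 1/2 attained somewhere. *)
  have e4 : (0 : R) < 4^-1 by rewrite invr_gt0.
  have [N [h1 h2]] := filter_ex (filterI (cb _ e4) (unif _ e4)).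
  have bN : 4 <= b N.
    move: h1; rewrite -be0 subr0 gtr0_norm// /c lef_pV2 ?posrE//.
  exfalso; have [_ _ [|[i [x [iM x01]]]]] := bP N; first by rewrite leNgt => /negP; apply; lra.
  have := h2 i x iM x01; rewrite (chain_zero dE E0 iM x01) subr0.
  rewrite derivnZ hornerZ normrM gtr0_norm// mulrC ler_pdivrMr//.
  by have := b0 N; lra.
have Ey (x : R) : 0 <= x <= 1 -> E 0%N x = be * y x.
  have sol : fide_solution n a d alpha f k (fun x => be^-1 * E 0%N x); last first.
    move=> x01; rewrite -(yuniq _ sol x x01) mulVKf// gt_eqF//.
  refine (fide_solution_chain am (G := fun i x => be^-1 * E i x)
    (fun _ _ => erefl) _ _ _ _).
  - by move=> i iM; apply: der01Z; exact: dE.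
  - by apply: continuous01Z; exact: cE.
  - move=> t t01; under eq_bigr do rewrite mulrCA.
    rewrite -mulr_sumr eqE// mulrDr mulKf ?gt_eqF//; congr (_ + _).
    by rewrite capformZr//; exact: bk.
  - by move=> i ni; rewrite iE// mulKf// gt_eqF.
have by_ : bddmeas01 y := continuous_bddmeas01 (cy 0%N (leq0n _)).
have [_ [Y yY]] := by_.
have Y0 : 0 <= Y by apply: le_trans (normr_ge0 _) (yY 0 _); rewrite lexx ler01.
(* The first bound gives [be / 2 <= c N], the second makes [e' * (Y + 1)] at most [be / 2 * e];
   dividing by [c N] then leaves [e]. *)
pose e' := Num.min (be / 2) (e * be / (2 * (Y + 1))).
have Y1 : 0 < 2 * (Y + 1) by rewrite mulr_gt0// ltr_wpDl.
have e'0 : 0 < e' by rewrite lt_min !divr_gt0// mulr_gt0.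
apply: filterS2 (cb e' e'0) (unif e' e'0) => N h1 h2.
have bN : bddmeas01 (fun x => y x - (yN N).[x]).
  apply: (@bddmeas01_ext _ (fun x => y x + -1 * (yN N).[x])) => [x _|]; first by rewrite mulN1r.
  by apply: bddmeas01D => //; apply: bddmeas01M; [exact: bddmeas01_cst | exact: bddmeas01_poly].
apply: L2norm01_le => // [|x x01]; first exact: ltW.
have ce : be / 2 <= c N.
  have e'b : e' <= be / 2 by rewrite ge_min lexx.
  by move: (le_trans h1 e'b); rewrite ler_norml => /andP[]; clear; lra.
rewrite -(ler_pM2l (c0 N)) -[X in X * `|_|]gtr0_norm// -normrM.
have -> : c N * (y x - (yN N).[x]) = (c N - be) * y x - ((p N)^`(0).[x] - E 0%N x).
  by rewrite Ey// derivn0 hornerZ; ring.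
rewrite (le_trans (ler_normB _ _))//; apply: (@le_trans _ _ (e' * (Y + 1))).
  by rewrite mulrDr mulr1 lerD ?h2// normrM ler_pM ?yY.
apply: (@le_trans _ _ (be / 2 * e)); last by rewrite ler_wpM2r// ltW.
have : e' <= e * be / (2 * (Y + 1)) by rewrite ge_min lexx orbT.
rewrite ler_pdivlMr//; lra.
Qed.

(* "Sufficiently smooth" is: of class C^r, for some r determined by the orders
   n and m of the problem. *)
Theorem theorem4p3 (R : realType) (n m : nat) :
  exists r : nat,
  forall (alpha : R) (a d : nat -> R) (f : R -> R) (k : R -> R -> R)
    (y : R -> R) (yN : nat -> {poly R}) (N0 : nat),
  0 < alpha -> m%:R - 1 < alpha <= m%:R ->
  a n != 0 ->
  Cn01 r f -> Cn01sq r k ->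
  fide_solution n a d alpha f k y ->
  (forall z : R -> R, fide_solution n a d alpha f k z ->
     forall t, 0 <= t <= 1 -> z t = y t) ->
  (forall N, (N0 <= N)%N -> cheb_legendre_approx n a d alpha f k N (yN N)) ->
  (fun N => L2norm01 (fun x => y x - (yN N).[x])) @ \oo --> (0 : R).
Proof.
have [r H] := ultra_L2 R n m; exists r.
move=> alpha a d f k y yN N0 _ am an0 fr kr ysol yuniq approx.
(* If the bound [e] failed for arbitrarily large N, the set of these N would belong to an
   ultrafilter finer than the filter at infinity, against [ultra_L2]. *)
apply/cvgrPdist_le => e e0; apply: contrapT => nH.
pose A := [set N | `|0 - L2norm01 (fun x => y x - (yN N).[x])| <= e].
have PW : ProperFilter (within (~` A) \oo).
  apply: Build_ProperFilter; rewrite /within/= => W; apply: nH.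
  by apply: filterS W => N; exact: contrapT.
have [U [UU WU]] := ultraFilterLemma PW.
have ooU : \oo `<=` U by move=> B oB; apply: WU; apply: filterS oB.
have nA : U (~` A) by apply: WU; rewrite /within; apply: nearW => N /=.
have UA := H alpha a d f k y yN N0 U UU ooU am an0 fr kr ysol yuniq approx e e0.
have [N [NA Ne]] := filter_ex (filterI nA UA); apply: NA.
by rewrite /A/= sub0r normrN ger0_norm; [exact: Ne | exact: sqrtr_ge0].
Qed.
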